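(* Let $M\geq 1$, let $\{T_m:1\leq m\leq M\}$ be star-commuting power partial isometries on a Hilbert space $H$, and set $I=\{u,s,b\}\cup \{p\in\mathbb{N}:p\geq 1\}$. For each multiindex $i=(i_1,\dots,i_M)\in I^M$, write $\Sigma_i:=\{m:1\leq m\leq M,\ i_m\neq u\}$, and for $m\in\Sigma_i$ set $K_{i,m}=\ell^2$ if $i_m=s$ or $i_m=b$, and $K_{i,m}=\mathbb{C}^p$ if $i_m=p$. Then there are closed subspaces $\{H_i:i\in I^M\}$ of $H$, all of which are reducing for all the $T_m$ and which satisfy $H=\bigoplus_{i\in I^M}H_i$, Hilbert spaces $\{M_i:i\in I^M\}$, and, for each $i\in I^M$, commuting unitaries $\{V_{i,m}\in U(M_i):i_m=u\}$, such that for each $i\in I^M$ the family $\{T_m|_{H_i}:1\leq m\leq M\}$ is simultaneously unitarily equivalent to the family of operators on $\big(\bigotimes_{n\in\Sigma_i}K_{i,n}\big)\otimes M_i$ whose $m$-th member is (1) $\big(\bigotimes_{n\in \Sigma_i}1_{K_{i,n}}\big)\otimes V_{i,m}$ if $i_m=u$; (2) $\big(\bigotimes_{n\in \Sigma_i,\, n\neq m}1_{K_{i,n}}\big)\otimes S\otimes 1_{M_i}$ if $i_m=s$; (3) $\big(\bigotimes_{n\in \Sigma_i,\, n\neq m}1_{K_{i,n}}\big)\otimes S^*\otimes 1_{M_i}$ if $i_m=b$; (4) $\big(\bigotimes_{n\in \Sigma_i,\, n\neq m}1_{K_{i,n}}\big)\otimes J_p\otimes 1_{M_i}$ if $i_m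=p$.
   Context: Hilbert spaces are complex, and operators are bounded and linear. A bounded operator $T$ on $H$ is a power partial isometry if $T^n$ is a partial isometry for all $n\geq 0$ (with $T^0=1$). A family $\{T_m\}$ star-commutes if $T_mT_n=T_nT_m$ for all $m,n$ and $T_m^*T_n=T_nT_m^*$ for $m\neq n$. A closed subspace $K$ of $H$ is reducing for $T$ if $TK\subseteq K$ and $T^*K\subseteq K$. Two families $\{T_m\}\subset B(H)$ and $\{S_m\}\subset B(K)$ (indexed by the same set) are simultaneously unitarily equivalent if there is a single unitary isomorphism $U$ of $H$ onto $K$ such that $UT_mU^*=S_m$ for all $m$. $U(M_i)$ denotes the group of unitary operators on $M_i$; the Hilbert spaces $M_i$ (and subspaces $H_i$) are allowed to be $\{0\}$. The symbols $u,s,b$ are three formal labels distinct from each other and from the positive integers. $S$ denotes the unilateral (forward) shift on $\ell^2=\ell^2(\mathbb{N})$, $Se_n=e_{n+1}$, and $S^*$ is its adjoint. For $p\geq 1$, the truncated shift $J_p$ on $\mathbb{C}^p$ is defined on the usual basis $e_1,\dots,e_p$ by $J_pe_n=e_{n+1}$ for $n<p$ and $J_pe_p=0$ (so $J_1=0$). Tensor products are Hilbert space tensor products, and an empty tensor product of spaces is $\mathbb{C}$. In (2)–(4) the operator $S$, $S^*$ or $J_p$ acts on the tensor factor $K_{i,m}$ (the factor with index $m$), with identity operators on all the other factors. Direct sums are orthogonal Hilbert space direct sums. *)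

(* Defs.v *)
From HB Require Import structures.
From mathcomp Require Import all_boot all_order all_algebra complex ring lra.
From mathcomp Require Import boolp classical_sets functions filter reals ereal.
From mathcomp Require Import finmap topology normedtype.
From mathcomp.analysis.showcase Require Import summability.
Set Implicit Arguments.
Unset Strict Implicit.
Unset Printing Implicit Defensive.
Import Order.TTheory GRing.Theory Num.Theory.
Import numFieldNormedType.Exports.
Local Open Scope classical_set_scope.
Local Open Scope ring_scope.
Local Open Scope complex_scope.

(* Complex Hilbert spaces, over R[i] for an arbitrary realType R; inner products
   are linear in the first argument and conjugate linear in the second. *)
HB.mixin Record CompleteNormedModule_isHilbert (R : realType) V
    & CompleteNormedModule R[i] V := {
  inner : {dot V for @Num.conj R[i]};
  inner_norm : forall x : V, inner x x = `|x| ^+ 2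
}.

#[short(type="hilbertType")]
HB.structure Definition Hilbert (R : realType) :=
  {V of CompleteNormedModule R[i] V & CompleteNormedModule_isHilbert R V}.

Section DotNorm.
Variables (C : numClosedFieldType) (V : lmodType C).
Variable f : {dot V for @Num.conj C}.

Lemma dot_CS u v : `|f u v| ^+ 2 <= f u u * f v v.
Proof.
have [->|v0] := eqVneq v 0.
  by rewrite linear0r /= normr0 expr0n/= linear0r mulr0.
have fv : 0 < f v v by rewrite dnorm_gt0.
have := dnorm_ge0 f (f v v *: u - f u v *: v).
rewrite dnormB !dnormZ /=.
rewrite !(linearZl_LR,linearZr_LR)/=.
rewrite !rmorphM/= conjCK.
have -> : (f v v)^*%R = f v v by apply: geC0_conj; apply: ltW.
rewrite (ger0_norm (ltW fv)).
have -> : (f u v)^*%R * f u v = `|f u v| ^+ 2 by rewrite mulrC normCK.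
set a := `|_| ^+ 2; set b := f v v in fv *.
rewrite -normCK -/a.
rewrite [X in 0 <= X -> _](_ : _ = b * (f u u * b - a)); last by ring.
by rewrite pmulr_rge0// subr_ge0.
Qed.

Definition dnorm u := sqrtC (f u u).

Lemma dnormD_le u v : dnorm (u + v) <= dnorm u + dnorm v.
Proof.
have ge0 w : 0 <= dnorm w by exact: sqrt_dnorm_ge0.
have sq w : dnorm w ^+ 2 = f w w by rewrite sqrtCK.
rewrite -ler_sqr ?nnegrE ?addr_ge0// sqrrD !sq dnormD addrAC lerD2r lerD2l.
have /le_trans-> // : f u v + (f u v)^*%R <= `|f u v| *+ 2.
  have := (leif_Re_Creal (f u v)).1.
  by rewrite ReE ler_pdivrMr ?ltr0n// mulr_natr.
rewrite lerMn2r/= -ler_sqr ?nnegrE ?mulr_ge0// exprMn !sq.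
exact: dot_CS.
Qed.

Lemma dnormZ_eq a u : dnorm (a *: u) = `|a| * dnorm u.
Proof. by rewrite /dnorm dnormZ sqrtCM ?nnegrE ?exprn_ge0// sqrCK. Qed.

Lemma dnorm0_eq0 u : dnorm u = 0 -> u = 0.
Proof. by move=> /eqP; rewrite sqrt_dnorm_eq0 => /eqP. Qed.

End DotNorm.

(* A module with a definite inner product whose norm is complete is a Hilbert
   space. *)
HB.factory Record Lmodule_isHilbert (R : realType) V & GRing.Lmodule R[i] V := {
  hinner : {dot V for @Num.conj R[i]};
  hinner_complete : forall F : set_system V, ProperFilter F ->
    (forall e, 0 < e -> exists x, F [set y | dnorm hinner (x - y) < e]) ->
    exists l, forall e, 0 < e -> F [set y | dnorm hinner (l - y) < e]
}.

HB.builders Context R V & Lmodule_isHilbert R V.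

HB.instance Definition _ := Lmodule_isNormed.Build R[i] V
  (@dnormD_le _ _ hinner) (@dnormZ_eq _ _ hinner) (@dnorm0_eq0 _ _ hinner).

Let complete : forall F : set_system V, ProperFilter F -> cauchy F -> cvg F.
Proof.
move=> F FF /cauchyP cF; apply/cvg_ex.
have [|l Fl] := hinner_complete FF.
  by move=> e e0; have [x xF] := cF _ e0; exists x; rewrite -ball_normE in xF.
by exists l; apply/cvgrPdist_lt => e e0; exact: Fl.
Qed.

HB.instance Definition _ := Uniform_isComplete.Build V complete.

Let normE (x : V) : hinner x x = `|x| ^+ 2.
Proof. by rewrite /Num.norm/= sqrtCK. Qed.

HB.instance Definition _ := CompleteNormedModule_isHilbert.Build R V normE.

HB.end.

Record is_dot (C : numClosedFieldType) (V : lmodType C) (op : V -> V -> C) :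
    Prop := IsDot {
  is_dotPl : forall a x y z, op (a *: x + y) z = a * op x z + op y z;
  is_dotC : forall x y, op x y = Num.conj (op y x);
  is_dot_gt0 : forall x, x != 0 -> 0 < op x x
}.

Section DotOf.
Variables (C : numClosedFieldType) (V : lmodType C) (op : V -> V -> C).
Hypothesis opP : is_dot op.

Definition dot_fun of is_dot op := op.
Local Notation f := (dot_fun opP).

Let addl z : zmod_morphism (f ^~ z).
Proof.
move=> x y; rewrite /dot_fun.
have := is_dotPl opP (-1) y x z; rewrite scaleN1r addrC => ->.
by rewrite mulN1r addrC.
Qed.

Let addr z : zmod_morphism (f z).
Proof.
move=> x y; rewrite /dot_fun !(is_dotC opP z).
by rewrite (addl z x y : op _ _ = _ - _) rmorphB.
Qed.

Let op0 z : op 0 z = 0.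
Proof. by have := addl z 0 0; rewrite /dot_fun !subrr. Qed.

Let scalel z : scalable_for *%R (f ^~ z).
Proof.
move=> a x; have := is_dotPl opP a x 0 z.
by rewrite op0 !addr0.
Qed.

Let scaler z : scalable_for (@Num.conj C \; *%R) (f z).
Proof.
move=> a x; rewrite /dot_fun !(is_dotC opP z).
by rewrite (scalel z a x : op _ _ = _ * _) rmorphM.
Qed.

HB.instance Definition _ := isBilinear.Build C V V C *%R (@Num.conj C \; *%R) f
  addl addr scalel scaler.

Let herm x y : f x y = (-1) ^+ false * Num.conj (f y x).
Proof. by rewrite mul1r; exact: (is_dotC opP). Qed.

HB.instance Definition _ :=
  isHermitianSesquilinear.Build C V false (@Num.conj C) f herm.
HB.instance Definition _ := isDotProduct.Build C V f (is_dot_gt0 opP).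

Definition dot_of : {dot V for @Num.conj C} := f.

Lemma dot_ofE x y : dot_of x y = op x y. Proof. by []. Qed.

End DotOf.

Record closedSubspace (R : realType) (H : hilbertType R) := ClosedSubspace {
  cs_set :> set H;
  cs_submod : submod_closed (mem cs_set);
  cs_closed : closed cs_set
}.

Section ClosedSubspaceHilbert.
Variables (R : realType) (H : hilbertType R) (K : closedSubspace H).

Definition cs_pred : {pred H} := mem (K : set H).
HB.instance Definition _ :=
  GRing.isSubmodClosed.Build R[i] H cs_pred (cs_submod K).

Record cs_type := CsType { cs_val :> H; cs_valP : cs_val \in cs_pred }.
HB.instance Definition _ := [isSub for cs_val].
HB.instance Definition _ := [Choice of cs_type by <:].
HB.instance Definition _ := [SubChoice_isSubLmodule of cs_type by <:].

Definition cs_inner (x y : cs_type) : R[i] := inner (val x) (val y).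

Lemma cs_inner_dot : is_dot cs_inner.
Proof.
split=> [a x y z|x y|x x0]; rewrite /cs_inner.
- by rewrite linearP linearDl linearZl_LR.
- by rewrite hermC/= mul1r.
- by rewrite dnorm_gt0; apply: contra x0 => /eqP x0; apply/eqP/val_inj.
Qed.

Let norm_cs x : dnorm (dot_of cs_inner_dot) x = `|val x|.
Proof.
by rewrite /dnorm dot_ofE /cs_inner inner_norm sqrCK.
Qed.

Lemma cs_complete (F : set_system cs_type) : ProperFilter F ->
  (forall e, 0 < e ->
    exists x, F [set y | dnorm (dot_of cs_inner_dot) (x - y) < e]) ->
  exists l, forall e, 0 < e ->
    F [set y | dnorm (dot_of cs_inner_dot) (l - y) < e].
Proof.
move=> FF cF.
have FG : ProperFilter (cs_val @ F) by exact: fmap_proper_filter.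
have cG : cvg (cs_val @ F).
  apply: cauchy_cvg; apply: cauchy_exP => e e0; have [x xF] := cF _ e0.
  exists (val x); rewrite -ball_normE.
  by apply: (@filterS _ F _ _ _ _ xF) => y /=; rewrite norm_cs raddfB.
have Kl : (K : set H) (lim (cs_val @ F)).
  apply: (closed_cvg (K : set H)) cG; first exact: cs_closed.
  by near=> x; exact: (set_mem (cs_valP x)).
exists (CsType (mem_set Kl)) => e e0.
have /cvgrPdist_lt/(_ _ e0) := cG.
by apply: (@filterS _ F) => y /=; rewrite norm_cs raddfB.
Unshelve. all: by end_near. Qed.

HB.instance Definition _ :=
  Lmodule_isHilbert.Build R cs_type cs_complete.

End ClosedSubspaceHilbert.

Section ComplexSums.
Variable R : realType.
Local Notation C := (R[i]).

Lemma Re_normC_le (z : C) : `|complex.Re z|%:C <= `|z|.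
Proof. exact: normc_ge_Re. Qed.

Lemma Im_normC_le (z : C) : `|complex.Im z|%:C <= `|z|.
Proof. by have := normc_ge_Re (z * (0 +i* 1)); rewrite ReiNIm normrN normrM complexiE normCi mulr1. Qed.

Lemma normC_le_ReIm (z : C) : `|z| <= (`|complex.Re z| + `|complex.Im z|)%:C.
Proof.
rewrite [X in `|X|]complexE (le_trans (ler_normD _ _))// normrM complexiE normCi.
by rewrite mul1r !normc_def/= expr0n/= !addr0 !sqrtr_sqr rmorphD.
Qed.

Lemma posC (e : C) : 0 < e -> exists2 r : R, 0 < r & e = r%:C.
Proof. by case: e => a b; rewrite ltcE/= => /andP[/eqP-> a0]; exists a. Qed.

Lemma C_complete (F : set_system C^o) : ProperFilter F ->
  (forall e : C, 0 < e -> exists x : C, F [set y | `|x - y| < e]) ->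
  exists l : C, forall e : C, 0 < e -> F [set y | `|l - y| < e].
Proof.
move=> FF cF.
have cvgpart (p : C -> R) : {morph p : x y / x - y} ->
    (forall z, `|p z|%:C <= `|z|) ->
    exists l : R, forall e : R, 0 < e -> F [set y | `|l - p y| < e].
  move=> pB ple.
  have : cvg (p @ F).
    apply: R_complete; apply: cauchy_exP => e e0.
    have [|x xF] := cF e%:C; first by rewrite ltcR.
    exists (p x); rewrite -ball_normE; apply: (@filterS _ F _ _ _ _ xF) => y /=.
    by move=> xy; rewrite -ltcR -pB; exact: le_lt_trans xy.
  by move=> /cvgrPdist_lt cvp; exists (lim (p @ F)) => e /cvp.
have [a Fa] := cvgpart (@complex.Re R) (fun x y => raddfB _ x y) Re_normC_le.
have [b Fb] := cvgpart (@complex.Im R) (fun x y => raddfB _ x y) Im_normC_le.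
exists (a +i* b) => e /posC[r r0 ->].
have r2 : 0 < r / 2 by rewrite divr_gt0.
apply: filterS2 (Fa _ r2) (Fb _ r2) => y /= ay by_.
apply: le_lt_trans (normC_le_ReIm _) _.
by case: y ay by_ => y1 y2 /= ay by_; rewrite ltcR [ltRHS]splitr ltrD.
Qed.

End ComplexSums.

#[global] Existing Instance totally_filter.

Section AbsSum.
Variables (R : realType) (X : choiceType).
Local Notation C := (R[i]).
Implicit Types (a b : X -> C) (A B : {fset X}).

(* csum is the unconditional sum, i.e. the limit of the partial sums along the
   directed set of finite subsets of X. *)
Definition abs_summable a :=
  exists M : C, forall A : {fset X}, \sum_(x <- A) `|a x| <= M.

Definition csum a : C := summability.sum (a : X -> C^o).

Lemma partial_sumE a A : partial_sum (a : X -> C^o) A = \sum_(x <- A) a x.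
Proof. by rewrite /partial_sum big_seq_fsetE. Qed.

Lemma abs_summable_cvg a : abs_summable a ->
  partial_sum (a : X -> C^o) @ totally --> (csum a : C^o).
Proof.
move=> [M aM]; suff : cvg (partial_sum (a : X -> C^o) @ totally) by [].
pose s A : R := complex.Re (\sum_(x <- A) `|a x|).
have sE A : (s A)%:C = \sum_(x <- A) `|a x|.
  by rewrite RRe_real// ger0_real// sumr_ge0.
have sup_s : has_sup (range s).
  split; first by exists (s fset0); exists fset0.
  exists (complex.Re M) => _ [A _ <-].
  by have := aM A; rewrite -sE lecE /= => /andP[].
have [l Fl] : exists l : C, forall e : C, 0 < e ->
    \forall A \near totally, `|l - partial_sum (a : X -> C^o) A| < e.
  apply: (@C_complete _ (partial_sum (a : X -> C^o) @ totally)).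
  move=> _ /posC[e e0 ->].
  have [_ [A0 _ <-] eA0] := sup_adherent e0 sup_s.
  exists (partial_sum (a : X -> C^o) A0); exists A0 => //= A /= A0A.
  rewrite !partial_sumE distrC (big_fsetID _ (mem A0) A)/=.
  have EA (f : X -> C) :
      \sum_(x <- [fset x in A | x \in A0]%fset) f x = \sum_(x <- A0) f x.
    apply: eq_fbigl => x; rewrite !inE /=; apply: andb_idl.
    exact: (fsubsetP A0A).
  rewrite EA addrC addrK (le_lt_trans (ler_norm_sum _ _ _))//.
  rewrite [X in X < _](_ : _ = (s A - s A0)%:C); last first.
    rewrite rmorphB/= !sE [in RHS](big_fsetID _ (mem A0) A)/= EA.
    by rewrite addrC addrK.
  rewrite ltcR ltrBlDr -ltrBlDl (le_lt_trans _ eA0)// lerD2r.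
  by apply: sup_upper_bound => //; exists A.
by apply/cvg_ex; exists l; apply/cvgrPdist_lt => e /Fl.
Qed.

Lemma abs_summable_le a b :
  (forall x, `|a x| <= `|b x|) -> abs_summable b -> abs_summable a.
Proof.
move=> ab [M bM]; exists M => A; apply: le_trans (bM A).
exact: ler_sum.
Qed.

Lemma abs_summableD a b : abs_summable a -> abs_summable b ->
  abs_summable (fun x => a x + b x).
Proof.
move=> [M aM] [N bN]; exists (M + N) => A.
apply: le_trans (lerD (aM A) (bN A)); rewrite -big_split/=.
by apply: ler_sum => x _; exact: ler_normD.
Qed.

Lemma abs_summableZ k a : abs_summable a -> abs_summable (fun x => k * a x).
Proof.
move=> [M aM]; exists (`|k| * M) => A.
under eq_bigr do rewrite normrM.
by rewrite -mulr_sumr ler_wpM2l.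
Qed.

Lemma csumP k a b : abs_summable a -> abs_summable b ->
  csum (fun x => k * a x + b x) = k * csum a + csum b.
Proof.
move=> sa sb; apply: (@cvg_lim C^o) => //.
have -> : partial_sum (fun x => k * a x + b x : C^o) =
    (fun A => k *: partial_sum (a : X -> C^o) A) \+
    partial_sum (b : X -> C^o).
  apply/funext => A /=; rewrite !partial_sumE big_split/= -mulr_sumr.
  by [].
by apply: cvgD; [apply: cvgZr|]; exact: abs_summable_cvg.
Qed.

Lemma csum_conj a : abs_summable a ->
  csum (fun x => Num.conj (a x)) = Num.conj (csum a).
Proof.
move=> sa; apply: (@cvg_lim C^o) => //.
have /cvgrPdist_lt cv := abs_summable_cvg sa.
apply/cvgrPdist_lt => e /cv; apply: filterS => A /=.
by rewrite !partial_sumE -rmorph_sum/= -rmorphB norm_conjC.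
Qed.

Lemma limC_ge0 (T : Type) (F : set_system T) (f : T -> C^o) (l : C^o) :
  ProperFilter F -> f @ F --> l -> (\forall t \near F, 0 <= (f t : C)) ->
  0 <= (l : C).
Proof.
move=> FF fl f0.
suff <- : `|l| = l :> C by exact: normr_ge0.
have fn : f @ F --> (`|l| : C^o).
  apply: cvg_trans (cvg_norm fl); apply: near_eq_cvg.
  by apply: filterS f0 => t /ger0_norm.
exact: (cvg_unique (@norm_hausdorff _ C^o) fn fl).
Qed.

Lemma csum_ge_fset a A : (forall x, 0 <= a x) -> abs_summable a ->
  \sum_(x <- A) a x <= csum a.
Proof.
move=> a0 sa; rewrite -subr_ge0.
have cv : (fun B => partial_sum (a : X -> C^o) B - \sum_(x <- A) a x) @ totally
    --> (csum a - \sum_(x <- A) a x : C^o).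
  by apply: cvgB; [exact: abs_summable_cvg|exact: cvg_cst].
apply: (limC_ge0 (@totally_filter X) cv); exists A => //= B /= AB.
rewrite partial_sumE subr_ge0 (big_fsetID _ (mem A) B)/=.
rewrite (_ : \sum_(i <- [fset x in B | x \in A]%fset) a i = \sum_(x <- A) a x).
  by rewrite lerDl sumr_ge0.
apply: eq_fbigl => x; rewrite !inE /=; apply: andb_idl.
exact: (fsubsetP AB).
Qed.

Lemma csum_le a M : abs_summable a ->
  (forall A, \sum_(x <- A) a x <= M) -> csum a <= M.
Proof.
move=> sa aM; rewrite -subr_ge0.
have cv : (fun B => (M : C^o) - partial_sum (a : X -> C^o) B) @ totally
    --> ((M : C^o) - csum a).
  by apply: (@cvgB _ C^o); [exact: cvg_cst|exact: abs_summable_cvg].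
by apply: (limC_ge0 (@totally_filter X) cv); apply: nearW => A; rewrite partial_sumE subr_ge0.
Qed.

End AbsSum.

Section L2.
Variables (R : realType) (X : choiceType).
Local Notation C := (R[i]).
Implicit Types (f g : X -> C^o) (A : {fset X}).

(* l2 R X is the space of square summable families indexed by X. Thus l2 R nat
   is the sequence space, and l2 R 'I_p is C^p with its Euclidean inner product
   (l2_fin_inner); the library's norm on 'rV[R[i]]_p is the sup norm. *)
Definition square_summable f :=
  exists M : C, forall A : {fset X}, \sum_(x <- A) `|f x| ^+ 2 <= M.

Definition l2_pred : {pred X -> C^o} := fun f => `[< square_summable f >].

Lemma square_summableP f : square_summable f ->
  abs_summable (fun x => `|f x| ^+ 2).
Proof. by move=> [M fM]; exists M => A; under eq_bigr do rewrite normrX normr_id. Qed.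

Lemma square_summable_mul f g : square_summable f -> square_summable g ->
  abs_summable (fun x => f x * Num.conj (g x)).
Proof.
move=> /square_summableP sf /square_summableP sg.
apply: abs_summable_le (abs_summableD sf sg) => x.
rewrite normrM norm_conjC [leRHS]ger0_norm; last by rewrite addr_ge0 ?exprn_ge0.
have uv0 : 0 <= `|f x| * `|g x| by rewrite mulr_ge0.
have : `|f x| \is Num.real /\ `|g x| \is Num.real by split; exact: normr_real.
move: `|f x| `|g x| uv0 => u v uv0 [ur vr].
apply: (@le_trans _ _ (u * v *+ 2)); first by rewrite mulr2n lerDl.
rewrite -subr_ge0 [leRHS](_ : _ = (u - v) ^+ 2); last by ring.
by rewrite real_exprn_even_ge0// rpredB.
Qed.

Fact l2_submod : submod_closed l2_pred.
Proof.
split=> [|a f g].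
  apply/asboolP; exists 0 => A; rewrite big1// => x _.
  by rewrite normr0 expr0n.
move=> /asboolP[M fM] /asboolP[N gN]; apply/asboolP.
exists ((`|a| ^+ 2 * M + N) *+ 2) => A.
apply: (@le_trans _ _ ((`|a| ^+ 2 * (\sum_(x <- A) `|f x| ^+ 2) +
   \sum_(x <- A) `|g x| ^+ 2) *+ 2)); last first.
  by rewrite lerMn2r/= lerD// ler_wpM2l// exprn_ge0.
rewrite mulr_sumr -big_split/= -sumrMnl; apply: ler_sum => x _.
rewrite -exprMn -normrM.
apply: (@le_trans _ _ ((`|a * f x| + `|g x|) ^+ 2)).
  by rewrite ler_sqr ?nnegrE ?addr_ge0//; exact: ler_normD.
have : `|a * f x| \is Num.real /\ `|g x| \is Num.real by split; exact: normr_real.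
move: `|a * f x| `|g x| => u v [ur vr]; rewrite -subr_ge0.
rewrite [leRHS](_ : _ = (u - v) ^+ 2); last by ring.
by rewrite real_exprn_even_ge0// rpredB.
Qed.

HB.instance Definition _ :=
  GRing.isSubmodClosed.Build C (X -> C^o) l2_pred l2_submod.

Record l2 := L2 { l2_fun :> X -> C^o; l2_funP : l2_fun \in l2_pred }.
HB.instance Definition _ := [isSub for l2_fun].
HB.instance Definition _ := [Choice of l2 by <:].
HB.instance Definition _ := [SubChoice_isSubLmodule of l2 by <:].

Definition l2_inner (f g : l2) : C := csum (fun x => f x * Num.conj (g x)).

Lemma l2_sq (f : l2) : square_summable f.
Proof. by have := l2_funP f => /asboolP. Qed.

Lemma l2_inner_summable (f g : l2) : abs_summable (fun x => f x * Num.conj (g x)).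
Proof. exact: square_summable_mul (l2_sq f) (l2_sq g). Qed.

Lemma l2_inner_ge_fset (f : l2) A : \sum_(x <- A) `|f x| ^+ 2 <= l2_inner f f.
Proof.
under eq_bigr do rewrite normCK.
apply: csum_ge_fset (l2_inner_summable f f) => x.
by rewrite -normCK exprn_ge0.
Qed.

Lemma l2_inner_le (f : l2) M :
  (forall A, \sum_(x <- A) `|f x| ^+ 2 <= M) -> l2_inner f f <= M.
Proof.
move=> fM; apply: csum_le (l2_inner_summable f f) _ => A.
by under eq_bigr do rewrite -normCK.
Qed.

Lemma l2_inner_dot : is_dot l2_inner.
Proof.
split=> [a f g h|f g|f f0].
- rewrite /l2_inner -csumP; [|exact: l2_inner_summable..].
  by congr csum; apply/funext => x/=; rewrite mulrDl mulrA.
- rewrite /l2_inner -csum_conj; last exact: l2_inner_summable.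
  by congr csum; apply/funext => x; rewrite rmorphM/= conjCK mulrC.
- have [x fx0] : exists x, f x != 0.
    apply: contrapT => /forallNP fx; move/eqP: f0; apply.
    by apply/val_inj/funext => x; apply/eqP; have /negP := fx x; rewrite negbK.
  apply: (@lt_le_trans _ _ (`|f x| ^+ 2)); first by rewrite exprn_gt0 ?normr_gt0.
  by have := l2_inner_ge_fset f [fset x]%fset; rewrite big_seq_fset1.
Qed.

Local Notation N := (dnorm (dot_of l2_inner_dot)).

Let N_ge0 (f : l2) : 0 <= N f. Proof. exact: sqrt_dnorm_ge0. Qed.

Lemma l2_norm_lt_fset (f : l2) A e : N f < e -> \sum_(x <- A) `|f x| ^+ 2 <= e ^+ 2.
Proof.
move=> fe; apply: le_trans (l2_inner_ge_fset f A) _.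
rewrite -[l2_inner f f]sqrtCK ler_sqr ?nnegrE//; first exact: ltW.
- exact: N_ge0.
- by apply: le_trans (ltW fe); exact: N_ge0.
Qed.

Lemma l2_complete (F : set_system l2) : ProperFilter F ->
  (forall e, 0 < e -> exists x, F [set y | N (x - y) < e]) ->
  exists l, forall e, 0 < e -> F [set y | N (l - y) < e].
Proof.
move=> FF cF.
have /choice[g Fg] : forall x, exists l : C^o, (fun f : l2 => (f x : C^o)) @ F --> l.
  move=> x.
  have [|l Fl] := @C_complete _ ((fun f : l2 => (f x : C^o)) @ F) _.
    move=> e e0; have [f Ff] := cF _ e0; exists (f x).
    apply: (@filterS _ F _ _ _ _ Ff) => h /= fh.
    have fhx : `|(f - h) x| ^+ 2 <= N (f - h) ^+ 2.
      rewrite sqrtCK; have := l2_inner_ge_fset (f - h) [fset x]%fset.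
      by rewrite big_seq_fset1.
    apply: le_lt_trans fh; rewrite -ler_sqr ?nnegrE//; exact: N_ge0.
  by exists l; apply/cvgrPdist_lt => e /Fl.
have gle (f : l2) (e : C) : 0 < e -> F [set y | N (f - y) < e] ->
    forall A : {fset X}, \sum_(x <- A) `|f x - g x| ^+ 2 <= e ^+ 2.
  move=> e0 Ff A; rewrite -subr_ge0.
  have cv : (fun h : l2 => (e ^+ 2 : C^o) - \sum_(x <- A) `|f x - h x| ^+ 2) @ F
      --> ((e ^+ 2 : C^o) - \sum_(x <- A) `|f x - g x| ^+ 2).
    apply: (@cvgB _ C^o); first exact: cvg_cst.
    apply: (@cvg_big C^o) => [|x _]; first exact: add_continuous.
    rewrite expr2; apply: (@cvgM C); apply: (@cvg_norm C C^o); apply: (@cvgB _ C^o) => //; exact: cvg_cst.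
  apply: (limC_ge0 FF cv); apply: (@filterS _ F _ _ _ _ Ff) => h /= fh.
  by rewrite subr_ge0; exact: (l2_norm_lt_fset A fh).
have gP : (g : X -> C^o) \in l2_pred.
  have [f Ff] := cF 1 ltr01.
  have fgP : (l2_fun f - g : X -> C^o) \in l2_pred.
    by apply/asboolP; exists (1 ^+ 2) => A; exact: gle.
  rewrite [g](_ : _ = l2_fun f - (l2_fun f - g)); last by rewrite opprB addrC subrK.
  by apply: rpredB => //; exact: l2_funP.
exists (L2 gP) => e e0; have e2 : 0 < e / 2 by rewrite divr_gt0.
have [f Ff] := cF _ e2.
apply: (@filterS _ F _ _ _ _ Ff) => h /= fh.
rewrite -(subrK f (L2 gP)) -addrA (le_lt_trans (dnormD_le _ _ _))//.
rewrite [ltRHS]splitr ler_ltD// -ler_sqr ?nnegrE; [|exact: N_ge0|exact: ltW].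
rewrite sqrtCK; apply: l2_inner_le => A.
under eq_bigr => x _ do rewrite /= distrC.
exact: gle.
Qed.

HB.instance Definition _ := Lmodule_isHilbert.Build R l2 l2_complete.
End L2.

Record bop (R : realType) (H K : hilbertType R) := Bop {
  bop_fun :> {linear H -> K};
  bop_bounded : exists M : R[i], forall x, `|bop_fun x| <= M * `|x|
}.

HB.instance Definition _ (R : realType) (H K : hilbertType R) :=
  gen_eqMixin (bop H K).
HB.instance Definition _ (R : realType) (H K : hilbertType R) :=
  gen_choiceMixin (bop H K).

Section Operators.
Variable R : realType.
Implicit Types H K : hilbertType R.

Fact bop0_bounded H K : exists M : R[i], forall x,
  `|(\0 : {linear H -> K}) x| <= M * `|x|.
Proof. by exists 0 => x; rewrite normr0 mul0r. Qed.

Definition bop0 H K : bop H K := Bop (bop0_bounded H K).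

Fact bop_id_bounded H : exists M : R[i], forall x,
  `|(idfun : {linear H -> H}) x| <= M * `|x|.
Proof. by exists 1 => x; rewrite mul1r. Qed.

Definition bop_id H : bop H H := Bop (bop_id_bounded H).

Lemma bop_ge0_bounded H K (T : bop H K) :
  exists M : R[i], forall x, `|T x| <= `|M| * `|x|.
Proof.
have [M TM] := bop_bounded T; exists M => x.
rewrite -[X in _ * X]normr_id -normrM ger0_norm//.
exact: le_trans (TM x).
Qed.

Fact bop_comp_bounded H K L (S : bop K L) (T : bop H K) : exists M : R[i],
  forall x, `|(S \o T : {linear H -> L}) x| <= M * `|x|.
Proof.
have [M SM] := bop_ge0_bounded S; have [N TN] := bop_ge0_bounded T.
exists (`|M| * `|N|) => x /=; apply: le_trans (SM _) _.
by rewrite -mulrA ler_wpM2l.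
Qed.

Definition bop_comp H K L (S : bop K L) (T : bop H K) : bop H L :=
  Bop (bop_comp_bounded S T).

Definition bop_exp H (T : bop H H) n := iter n (bop_comp T) (bop_id H).

(* Unique by nondegeneracy, and it exists by the Riesz representation theorem;
   the default value bop0 is never taken. *)
Definition adjoint H K (T : bop H K) : bop K H :=
  xget (bop0 K H) [set S | forall x y, inner (T x) y = inner x (S y)].

(* T is isometric on the orthogonal complement of its kernel. *)
Definition partial_isometry H K (T : bop H K) := forall x,
  (forall y, T y = 0 -> inner x y = 0) -> `|T x| = `|x|.

Definition power_partial_isometry H (T : bop H H) :=
  forall n, partial_isometry (bop_exp T n).

Definition star_commuting H (I : Type) (T : I -> bop H H) :=
  (forall m n, bop_comp (T m) (T n) =1 bop_comp (T n) (T m)) /\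
  (forall m n, m <> n ->
    bop_comp (adjoint (T m)) (T n) =1 bop_comp (T n) (adjoint (T m))).

(* Unitary isomorphism of H onto K. *)
Definition unitary_op H K (U : bop H K) :=
  (forall x y, inner (U x) (U y) = inner x y) /\ (forall y, exists x, U x = y).

Definition simul_unitarily_equiv H K (I : Type)
    (T : I -> bop H H) (S : I -> bop K K) :=
  exists2 U : bop H K, unitary_op U &
    forall m, bop_comp U (bop_comp (T m) (adjoint U)) =1 S m.

Definition invariant_subspace H (K : closedSubspace H) (T : bop H H) :=
  T @` K `<=` K.

Definition reducing H (K : closedSubspace H) (T : bop H H) :=
  invariant_subspace K T /\ invariant_subspace K (adjoint T).

Section Restriction.
Variables (H : hilbertType R) (K : closedSubspace H) (T : bop H H).
Hypothesis KT : invariant_subspace K T.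

Fact restrict_subproof (x : cs_type K) : T (val x) \in cs_pred K.
Proof. by apply/mem_set/KT; exists (val x) => //; apply: set_mem; exact: cs_valP. Qed.

Definition restrict_fun (x : cs_type K) : cs_type K :=
  CsType (restrict_subproof x).

Fact restrict_linear : linear restrict_fun.
Proof. by move=> a x y; apply/val_inj; rewrite /= linearP. Qed.

HB.instance Definition _ :=
  GRing.isLinear.Build R[i] (cs_type K) (cs_type K) *:%R restrict_fun
    restrict_linear.

Lemma cs_norm (x : cs_type K) : `|x| = `|val x|.
Proof.
apply/eqP; rewrite -(@eqrXn2 _ 2)//.
by rewrite -!inner_norm.
Qed.

Fact restrict_bounded : exists M : R[i], forall x,
  `|restrict_fun x| <= M * `|x|.
Proof. by have [M TM] := bop_bounded T; exists M => x; rewrite !cs_norm; exact: TM. Qed.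

Definition restrict_op : bop (cs_type K) (cs_type K) := Bop restrict_bounded.

End Restriction.

Definition lin_span (V : lmodType R[i]) (A : set V) : set V :=
  [set x | exists n (c : 'I_n -> R[i]) (v : 'I_n -> V),
    (forall k, A (v k)) /\ x = \sum_k c k *: v k].

Definition orthogonal_direct_sum H (I : Type) (K : I -> closedSubspace H) :=
  (forall i j, i <> j -> forall x y, cs_set (K i) x -> cs_set (K j) y -> inner x y = 0) /\
  dense (lin_span (\bigcup_i K i)).

End Operators.

Section Pullback.
Variables (R : realType) (X : choiceType) (P : pred X) (phi : X -> X).
Hypothesis phi_inj : {in predC P &, injective phi}.

(* The operator f |-> (x |-> 0 if P x, and f (phi x) otherwise), from which the
   shift (f_n |-> f_(n-1), with f_(-1) = 0) and its truncations are obtained. *)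
Definition pullback (f : X -> R[i]^o) : X -> R[i]^o :=
  fun x => if P x then 0 else f (phi x).

Lemma pullback_sum (f : X -> R[i]^o) (A : {fset X}) :
  exists B : {fset X},
    \sum_(x <- A) `|pullback f x| ^+ 2 = \sum_(x <- B) `|f x| ^+ 2.
Proof.
exists [fset phi x | x in [fset x in A | ~~ P x]]%fset.
rewrite big_imfset/=; last first.
  by move=> x y; rewrite !inE/= => /andP[_ Px] /andP[_ Py]; exact: phi_inj.
rewrite (big_fsetID _ P A)/= [X in X + _]big1_fset ?add0r; last first.
  by move=> x; rewrite !inE/= => /andP[_ Px] _; rewrite /pullback Px normr0 expr0n.
apply: eq_big_seq => x; rewrite !inE/= => /andP[_ /negbTE Px].
by rewrite /pullback Px.
Qed.

Fact pullback_l2 (f : l2 R X) : pullback f \in @l2_pred R X.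
Proof.
apply/asboolP; have [M fM] := l2_sq f; exists M => A.
by have [B ->] := pullback_sum f A.
Qed.

Definition l2_pullback (f : l2 R X) : l2 R X := L2 (pullback_l2 f).

Fact l2_pullback_linear : linear l2_pullback.
Proof.
move=> a f g; apply/val_inj/funext => x /=; rewrite /pullback.
rewrite [RHS]/GRing.add/= /GRing.scale/=; case: (P x) => //.
by rewrite scaler0 addr0.
Qed.

HB.instance Definition _ :=
  GRing.isLinear.Build R[i] (l2 R X) (l2 R X) *:%R l2_pullback
    l2_pullback_linear.

Lemma l2_norm_sq (f : l2 R X) : `|f| ^+ 2 = l2_inner f f.
Proof. by rewrite -inner_norm. Qed.

Fact l2_pullback_bounded : exists M : R[i], forall f,
  `|l2_pullback f| <= M * `|f|.
Proof.
exists 1 => f; rewrite mul1r -ler_sqr ?nnegrE// !l2_norm_sq.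
apply: l2_inner_le => A; have [B ->] := pullback_sum f A.
exact: l2_inner_ge_fset.
Qed.

Definition pullback_op : bop (l2 R X) (l2 R X) := Bop l2_pullback_bounded.

End Pullback.

Section Shifts.
Variable R : realType.

Fact shift_inj : {in predC (pred1 0%N) &, injective predn}.
Proof. by move=> [|m] [|n]//= _ _ ->. Qed.

Definition unilateral_shift : bop (l2 R nat) (l2 R nat) := pullback_op R shift_inj.

Fact trunc_inj p :
  {in predC (fun j : 'I_p => j == 0%N :> nat) &, injective (@ord_pred p)}.
Proof. by move=> i j _ _; exact: ord_pred_inj. Qed.

Definition trunc_shift p : bop (l2 R 'I_p) (l2 R 'I_p) :=
  pullback_op R (@trunc_inj p).

Definition l2_delta_fun (X : choiceType) (x : X) : X -> R[i]^o :=
  fun y => (y == x)%:R.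

Fact l2_delta_subproof (X : choiceType) (x : X) : l2_delta_fun x \in @l2_pred R X.
Proof.
apply/asboolP; exists 1 => A; rewrite (big_fsetID _ (pred1 x) A)/=.
rewrite [X in _ + X]big1_fset ?addr0; last first.
  move=> y; rewrite !inE/= => /andP[_ /negbTE yx] _.
  by rewrite /l2_delta_fun yx normr0 expr0n.
have [xA|xA] := boolP (x \in A); last first.
  rewrite big1_fset// => y; rewrite !inE/= => /andP[yA /eqP yx] _.
  by rewrite -yx yA in xA.
rewrite (_ : [fset y in A | y == x]%fset = [fset x]%fset).
  by rewrite big_seq_fset1 /l2_delta_fun eqxx normr1 expr1n.
by apply/fsetP => y; rewrite !inE/= andb_idl// => /eqP->.
Qed.

Definition l2_delta (X : choiceType) (x : X) : l2 R X := L2 (l2_delta_subproof x).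

Lemma shift_delta n : unilateral_shift (l2_delta n) = l2_delta n.+1.
Proof. by apply/val_inj/funext => -[|k]. Qed.

Lemma ord_predE p (k : 'I_p) : k != 0%N :> nat -> ord_pred k = k.-1 :> nat.
Proof.
case: k => -[|k] kp //= _.
by rewrite modnDr modn_small// ltnW.
Qed.

Lemma trunc_shift_l2_delta p (i j : 'I_p) : j = i.+1 :> nat ->
  trunc_shift p (l2_delta i) = l2_delta j.
Proof.
move=> ji; apply/val_inj/funext => k /=; rewrite /pullback /l2_delta_fun.
rewrite -!val_eqE/= ji; case: ifPn => [/eqP -> //|k0].
by rewrite -[X in X == _]/(ord_pred k : nat) ord_predE//; case: (k : nat) k0.
Qed.

Lemma trunc_shift_delta_last p (i : 'I_p) : i.+1 = p ->
  trunc_shift p (l2_delta i) = 0.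
Proof.
move=> ip; apply/val_inj/funext => k /=; rewrite /pullback /l2_delta_fun.
case: ifPn => // k0; rewrite -val_eqE -[X in X == _]/(ord_pred k : nat).
rewrite ord_predE//; case: (k : nat) k0 (ltn_ord k) => // n _ /=.
by rewrite -{1}ip ltnS => /ltn_eqF ->.
Qed.

Lemma l2_fin_inner (X : finType) (f g : l2 R X) :
  inner f g = \sum_x f x * Num.conj (g x).
Proof.
have cv := abs_summable_cvg (l2_inner_summable f g).
apply: (cvg_unique (@norm_hausdorff _ (R[i])^o) cv).
apply: cvg_near_cst; exists [fset x | x : X]%fset => //= A XA.
rewrite partial_sumE big_uniq ?fset_uniq//; apply: eq_bigl => x.
by apply: (fsubsetP XA); rewrite !inE.
Qed.

End Shifts.

(* A realization of the Hilbert space tensor product of a finite family: a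
   Hilbert space with a multilinear map whose values, the elementary tensors,
   span a dense subspace and satisfy
   <(x)_j x_j, (x)_j y_j> = prod_j <x_j, y_j>.
   It is unique up to the unitary matching elementary tensors. For an empty
   family it is the one-dimensional space spanned by a unit vector. *)
Record hilbertTensor (R : realType) (J : finType) (K : J -> hilbertType R) :=
  HilbertTensor {
    tensor_space :> hilbertType R;
    tensor : (forall j, K j) -> tensor_space;
    tensor_linear : forall (x : forall j, K j) j (a : R[i]) (u v : K j),
      tensor (dfwith x (a *: u + v)) =
      a *: tensor (dfwith x u) + tensor (dfwith x v);
    tensor_inner : forall x y : (forall j, K j),
      inner (tensor x) (tensor y) = \prod_j inner (x j) (y j);
    tensor_dense : dense (lin_span (range tensor))
  }.

Record hilbertTensor2 (R : realType) (H K : hilbertType R) :=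
  HilbertTensor2 {
    tensor2_space :> hilbertType R;
    tensor2 : H -> K -> tensor2_space;
    tensor2_linearl : forall y, linear (tensor2 ^~ y);
    tensor2_linearr : forall x, linear (tensor2 x);
    tensor2_inner : forall x x' y y',
      inner (tensor2 x y) (tensor2 x' y') = inner x x' * inner y y';
    tensor2_dense :
      dense (lin_span [set z | exists x y, z = tensor2 x y])
  }.

(* The bounded operators (x)_j A_j and A (x) B, determined by their values on
   elementary tensors; they always exist, so the default bop0 is never taken. *)
Section TensorOperators.
Variable R : realType.

Definition tensor_op (J : finType) (K : J -> hilbertType R)
    (F : hilbertTensor K) (A : forall j, bop (K j) (K j)) : bop F F :=
  xget (bop0 F F) [set B | forall x, B (tensor F x) =
                                     tensor F (fun j => A j (x j))].

Definition tensor2_op (H K : hilbertType R) (E : hilbertTensor2 H K)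
    (A : bop H H) (B : bop K K) : bop E E :=
  xget (bop0 E E) [set C | forall x y, C (tensor2 E x y) =
                                       tensor2 E (A x) (B y)].

End TensorOperators.

(* The index set {u, s, b} + {p : nat | 1 <= p}. *)
Inductive label := lab_u | lab_s | lab_b | lab_fin (p : nat) of (0 < p)%N.

Definition is_u (l : label) := if l is lab_u then true else false.

Section Model.
Variable R : realType.

(* Only used for labels other than lab_u, for which the value is irrelevant. *)
Definition factor (l : label) : hilbertType R :=
  if l is lab_fin p _ then l2 R 'I_p else l2 R nat.

Definition factor_op (l : label) : bop (factor l) (factor l) :=
  match l with
  | lab_u => bop_id _
  | lab_s => unilateral_shift R
  | lab_b => adjoint (unilateral_shift R)
  | lab_fin p _ => trunc_shift R p
  end.

Variables (M : nat) (i : 'I_M -> label).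

Definition Sigma : finType := {m : 'I_M | ~~ is_u (i m)}.

Definition factors (n : Sigma) : hilbertType R := factor (i (val n)).

Variables (F : hilbertTensor factors) (L : hilbertType R).
Variables (E : hilbertTensor2 F L) (V : 'I_M -> bop L L).

(* Only the V m with i m = lab_u are used. *)
Definition model_op (m : 'I_M) : bop E E :=
  if is_u (i m) then
    tensor2_op E (tensor_op F (fun n => bop_id (factors n))) (V m)
  else
    tensor2_op E
      (tensor_op F (fun n => if val n == m then factor_op (i (val n))
                             else bop_id (factors n)))
      (bop_id L).

End Model.

Arguments factors R [M] i n.

(* Main.v *)
Require Import Defs.
From HB Require Import structures.
From mathcomp Require Import all_boot all_order all_algebra complex ring lra.
From mathcomp Require Import boolp classical_sets functions filter reals ereal.
From mathcomp Require Import finmap topology normedtype.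
From mathcomp.analysis.showcase Require Import summability.
Set Implicit Arguments.
Unset Strict Implicit.
Unset Printing Implicit Defensive.
Import Order.TTheory GRing.Theory Num.Theory.
Import numFieldNormedType.Exports.
Local Open Scope classical_set_scope.
Local Open Scope ring_scope.
Local Open Scope complex_scope.

(** Write T' for the adjoint of T. If T is a power partial isometry, then
    P_n = T^n T'^n and Q_n = T'^n T^n are orthogonal projections, both sequences
    decrease, and every P_n commutes with every Q_k because T^(k + n) is again a
    partial isometry. The differences P_a - P_(a+1), together with the limit of
    the P_n, cut H into orthogonal pieces indexed by N and a point oo; the Q_n
    do the same. Hence H is cut into cells, indexed by pairs (c, d) of elements
    of N with oo. The operator T maps the cell (c, d + 1) isometrically onto the
    cell (c + 1, d), with inverse T', and it kills the cells (c, 0)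
    ([cell_shift], [cell_kill]). The orbits of this motion are the possible
    summands: (oo, oo) is fixed and carries a unitary; the cells (k, oo) form a
    forward shift, the cells (oo, k) a backward shift, and for each p >= 1 the
    chain of the cells (k, p - 1 - k) with k < p is a truncated shift J_p. A
    label names an orbit, and a position k names a cell on it.

    For a star-commuting family the cells of one operator are preserved by the
    others and their adjoints, so the cells can be intersected. A joint cell is
    given by one label i_m and one position x_m for each m. Distinct joint cells
    are orthogonal, and a vector orthogonal to all of them is zero
    ([label_cells_total]): a nonzero vector has a nonzero projection on a cell of
    the first operator, that projection has a nonzero projection on a cell of
    the second one, and so on, and these projections preserve the orthogonal
    complement of the joint cells. The summand H_i is the closed span of the joint
    cells of label i, realized as a double orthogonal complement, and the
    multiplicity space M_i is the joint cell at the position 0. The word W_x, a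
    product of powers of the T_m (of T_m' where i_m = b), is an isometry of M_i
    onto the joint cell at x.

    The square summable families on the set of positions are a tensor product of
    the factor spaces ([ftensor_inner], which is Fubini's theorem for a product of
    sums). The space H_i itself is then a tensor product of that space with M_i,
    the elementary tensor of f and y being the orthogonal series
    sum_x f(x) W_x y ([tensor_series]). With this choice the unitary equivalence
    is the identity, and it remains to recognize T_m on elementary tensors. Since
    a vector v of H_i is determined by its inner products with the W_x y, one
    needs only the action of T_m' on words: it changes one coordinate of x or
    gives 0 ([adjoint_full_word]), and this is exactly the operator S, S' or J_p
    on the factor m ([pull_coord_op_tensor]).

    Adjoints exist by the Riesz representation theorem ([riesz]), which also
    gives the density of the span of a family with trivial orthogonal complement
    ([total_dense]). *)

(** * Inner products and the Riesz representation theorem *)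

Section Inner.
Variables (R : realType) (H : hilbertType R).
Local Notation C := (R[i]).
Implicit Types (x y z : H) (a : C).

Lemma innerDl x y z : inner (x + y) z = inner x z + inner y z.
Proof. by rewrite linearDl. Qed.

Lemma innerDr x y z : inner z (x + y) = inner z x + inner z y.
Proof. by rewrite linearDr. Qed.

Lemma innerZl a x z : inner (a *: x) z = a * inner x z.
Proof. by rewrite linearZl_LR. Qed.

Lemma innerZr a x z : inner z (a *: x) = Num.conj a * inner z x.
Proof. by rewrite linearZr_LR. Qed.

Lemma innerBl x y z : inner (x - y) z = inner x z - inner y z.
Proof. by rewrite linearBl. Qed.

Lemma innerBr x y z : inner z (x - y) = inner z x - inner z y.
Proof. by rewrite linearBr. Qed.

Lemma inner0l z : inner 0 z = 0 :> C.
Proof. by rewrite linear0l. Qed.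

Lemma inner0r z : inner z 0 = 0 :> C.
Proof. by rewrite linear0r. Qed.

Lemma inner_conj x y : inner x y = Num.conj (inner y x).
Proof. by rewrite hermC/= mul1r. Qed.

Lemma inner_eq0C x y : inner x y = 0 -> inner y x = 0.
Proof. by move=> xy; rewrite inner_conj xy rmorph0. Qed.

Lemma inner_suml (I : Type) (r : seq I) (P : pred I) (E : I -> H) z :
  inner (\sum_(i <- r | P i) E i) z = \sum_(i <- r | P i) inner (E i) z.
Proof. exact: linear_sumlz. Qed.

Lemma inner_sumr (I : Type) (r : seq I) (P : pred I) (E : I -> H) z :
  inner z (\sum_(i <- r | P i) E i) = \sum_(i <- r | P i) inner z (E i).
Proof. exact: linear_sumr. Qed.

Lemma inner_xx_eq0 x : inner x x = 0 -> x = 0.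
Proof. by move/eqP; rewrite dnorm_eq0 => /eqP. Qed.

Lemma inner_ext x y : (forall z, inner x z = inner y z) -> x = y.
Proof.
move=> xy; apply/eqP; rewrite -subr_eq0; apply/eqP/inner_xx_eq0.
by rewrite innerBl xy subrr.
Qed.

Lemma inner_CS x y : `|inner x y| <= `|x| * `|y|.
Proof.
rewrite -ler_sqr ?nnegrE ?mulr_ge0// exprMn -!inner_norm.
exact: dot_CS.
Qed.

Lemma normB_sq x y :
  `|x - y| ^+ 2 = `|x| ^+ 2 + `|y| ^+ 2 - (inner x y + inner y x).
Proof. by rewrite -!inner_norm innerBl !innerBr; ring. Qed.

Lemma normD_sq x y :
  `|x + y| ^+ 2 = `|x| ^+ 2 + `|y| ^+ 2 + (inner x y + inner y x).
Proof. by rewrite -!inner_norm innerDl !innerDr; ring. Qed.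

Lemma cvg_innerl (I : Type) (F : set_system I) {FF : Filter F} (f : I -> H) x z :
  f @ F --> x -> (fun t => inner (f t) z : C^o) @ F --> (inner x z : C^o).
Proof.
move=> /cvgrPdist_lt fx; apply/cvgrPdist_lt => e e0.
have z0 : 0 < `|z| + 1 by rewrite ltr_wpDl.
have := fx (e / (`|z| + 1)); rewrite divr_gt0// => /(_ isT).
apply: filterS => t xt; rewrite -innerBl (le_lt_trans (inner_CS _ _))//.
apply: le_lt_trans (_ : `|x - f t| * (`|z| + 1) < _).
  by rewrite ler_wpM2l// lerDl.
by rewrite -ltr_pdivlMr.
Qed.

Lemma cvg_innerr (I : Type) (F : set_system I) {FF : Filter F} (f : I -> H) x z :
  f @ F --> x -> (fun t => inner z (f t) : C^o) @ F --> (inner z x : C^o).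
Proof.
move=> fx; have := @cvg_innerl _ _ FF _ _ z fx.
move=> /(@cvgrPdist_lt _ C^o) {}fx.
apply/cvgrPdist_lt => e e0.
apply: filterS (fx _ e0) => t.
by rewrite [inner z x]inner_conj [inner z _]inner_conj -rmorphB/= norm_conjC.
Qed.

Lemma cvgC_unique (I : Type) (F : set_system I) {FF : ProperFilter F}
  (f : I -> C^o) (a b : C^o) : f @ F --> a -> f @ F --> b -> a = b.
Proof. by move=> fa fb; exact: (cvg_unique (@norm_hausdorff _ C^o) fa fb). Qed.

Section Riesz.
Variables (phi : {linear H -> C^o}) (M : C).
Hypothesis phiM : forall x, `|phi x| <= M * `|x|.

Let re (a : C) : R := complex.Re a.
Let J x : R := re (`|x| ^+ 2 - (phi x + Num.conj (phi x))).

Let JE x : (J x)%:C = `|x| ^+ 2 - (phi x + Num.conj (phi x)).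
Proof.
rewrite /J /re RRe_real// rpredB//.
  by rewrite rpredX// normr_real.
by rewrite CrealE rmorphD/= conjCK addrC.
Qed.

Let J_lb x : - re (`|M| ^+ 2) <= J x.
Proof.
rewrite -lecR rmorphN JE [X in - X](_ : _ = `|M| ^+ 2); last first.
  exact: (RRe_real (rpredX _ (normr_real _))).
have h : phi x + Num.conj (phi x) <= `|M| * `|x| *+ 2.
  apply: le_trans (real_ler_norm _) _.
    by rewrite CrealE rmorphD/= conjCK addrC.
  rewrite (le_trans (ler_normD _ _))// norm_conjC mulr2n lerD//.
    by rewrite -[X in _ * X]normr_id -normrM (le_trans (phiM _))// real_ler_norm//
      ger0_real// (le_trans _ (phiM x)).
  by rewrite -[X in _ * X]normr_id -normrM (le_trans (phiM _))// real_ler_norm//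
    ger0_real// (le_trans _ (phiM x)).
rewrite -subr_ge0 opprK.
apply: (@le_trans _ _ (`|x| ^+ 2 - `|M| * `|x| *+ 2 + `|M| ^+ 2)); last first.
  by rewrite lerD2r lerB.
rewrite [leRHS](_ : _ = (`|x| - `|M|) ^+ 2); last by ring.
by rewrite real_exprn_even_ge0// rpredB// normr_real.
Qed.

Let j := inf (range J).

Let hasinf : has_inf (range J).
Proof.
split; first by exists (J 0), 0.
by exists (- re (`|M| ^+ 2)) => _ [x _ <-]; exact: J_lb.
Qed.

Let j_le x : j <= J x.
Proof. by apply: ge_inf; [exact: hasinf.2|exists x]. Qed.

Let near_min : set_system H :=
  filter_from [set e : R | 0 < e] (fun e => [set x | J x < j + e]).

Let near_min_filter : ProperFilter near_min.
Proof.
apply: filter_from_proper; last first.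
  move=> e /= e0; have [_ [x _ <-] xe] := inf_adherent e0 hasinf.
  by exists x.
apply: filter_from_filter; first by exists 1 => /=.
move=> e f /= e0 f0; exists (Num.min e f); first by rewrite /= lt_min e0.
by move=> x /= xef; split; apply: lt_le_trans xef _;
  rewrite lerD2l ge_min lexx ?orbT.
Qed.

Let J_parallelogram x y :
  (J x + J y)%:C = (J (2^-1 *: (x + y)) *+ 2)%:C + `|x - y| ^+ 2 / 2.
Proof.
rewrite rmorphD rmorphMn/= !JE normrZ exprMn normB_sq.
have -> : phi (2^-1 *: (x + y)) = 2^-1 * (phi x + phi y).
  by rewrite linearZ linearD.
rewrite normD_sq ger0_norm ?invr_ge0// rmorphM rmorphD/= fmorphV/= rmorph_nat.
by field.
Qed.

Let near_min_dist x y e : J x < j + e -> J y < j + e ->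
  `|x - y| ^+ 2 <= (e *+ 4)%:C.
Proof.
move=> xe ye; have h : (J x + J y - J (2^-1 *: (x + y)) *+ 2)%:C = `|x - y| ^+ 2 / 2.
  by rewrite rmorphB/= J_parallelogram addrC addKr.
have -> : `|x - y| ^+ 2 = ((J x + J y - J (2^-1 *: (x + y)) *+ 2) *+ 2)%:C.
  by rewrite rmorphMn/= h -mulr_natr divfK.
rewrite lecR; have := j_le (2^-1 *: (x + y)); move: xe ye; rewrite !mulr2n !mulrS;
  lra.
Qed.

(** The representing vector minimizes the functional J(x) = |x|^2 - 2 Re phi(x).
    By the parallelogram identity two vectors at which J is within e of its
    infimum are at distance at most 2 sqrt e, so the near-minimizers generate
    a Cauchy filter, and the first variation of J vanishes at its limit. *)
Lemma riesz : exists z, forall x, phi x = inner x z.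
Proof.
have FF : ProperFilter near_min := near_min_filter.
have cF : cvg near_min.
  apply: (@cauchy_cvg _ near_min near_min_filter).
  apply: cauchy_exP => e /posC[r r0 ->].
  pose d := (r / 3) ^+ 2.
  have d0 : 0 < d by rewrite exprn_gt0// divr_gt0.
  have [_ [x _ <-] xe] := inf_adherent d0 hasinf.
  (* The ball is centred at a near-minimizer at which J is below its infimum plus
     d = (r / 3)^2; then 4 d < r^2. *)
  exists x, d => //= y /= ye; rewrite -ball_normE/=.
  have rC : 0 < r%:C by rewrite ltcR.
  rewrite -ltr_sqr ?nnegrE ?(ltW rC)//.
  apply: le_lt_trans (near_min_dist xe ye) _.
  rewrite -rmorphXn/= ltcR /d; have : 0 < r ^+ 2 by rewrite exprn_gt0.
  have -> : (r / 3) ^+ 2 *+ 4 = r ^+ 2 * (4 / 9) by field.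
  lra.
pose z := lim near_min; exists z => h; apply/esym/eqP; rewrite -subr_eq0.
have h0 : 0 < 1 + `|h| ^+ 2 by rewrite ltr_wpDr// exprn_ge0.
(* The first variation: comparing J at x and at x + t h bounds the defect
   <h, x> - phi h by the distance e of J x from its infimum. *)
have key (e : R) x : J x < j + e ->
    `|inner h x - phi h| ^+ 2 <= e%:C * (1 + `|h| ^+ 2).
  move=> xe; set g := inner h x - phi h.
  pose s := (1 + `|h| ^+ 2)^-1.
  have s0 : 0 < s by rewrite invr_gt0.
  have sr : Num.conj s = s by apply: geC0_conj; exact: ltW.
  (* This t nearly minimizes the quadratic J (x + t h). *)
  pose t := - (s * Num.conj g).
  have := le_lt_trans (lexx (J x)) xe.
  move=> /lt_le_trans/(_ (_ : j + e <= J (x + t *: h) + e)).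
  rewrite lerD2r j_le => /(_ isT); rewrite -ltcR rmorphD/= !JE.
  have -> : phi (x + t *: h) = phi x + t * phi h by rewrite linearD linearZ.
  rewrite normD_sq innerZl innerZr normrZ exprMn rmorphD rmorphM/=.
  rewrite -subr_gt0 => /ltW.
  rewrite [inner x h]inner_conj.
  rewrite [leRHS](_ : _ = t * g + Num.conj (t * g) + `|t| ^+ 2 * `|h| ^+ 2 + e%:C);
    last first.
    by rewrite /g rmorphM rmorphB/=; ring.
  rewrite /t normrN normrM norm_conjC (ger0_norm (ltW s0)) !rmorphM rmorphN rmorphM/=
    sr conjCK.
  rewrite [leRHS](_ : _ = e%:C - s * `|g| ^+ 2 + s * `|g| ^+ 2 * (s * `|h| ^+ 2 - 1));
    last first.
    by rewrite exprMn (normCK g); ring.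
  have -> : s * `|h| ^+ 2 - 1 = - s.
    by rewrite /s; field; rewrite gt_eqF.
  have sg : 0 <= s * `|g| ^+ 2 * s by rewrite !mulr_ge0// ?ltW// exprn_ge0.
  rewrite mulrN => h1; have : s * `|g| ^+ 2 <= e%:C.
    by rewrite -subr_ge0 (le_trans h1)// gerDl oppr_le0.
  by rewrite /s mulrC ler_pdivrMr.
have cv : (fun x => inner h x - phi h : C^o) @ near_min --> (inner h z - phi h : C^o).
  by apply: (@cvgB _ C^o); [exact: cvg_innerr|exact: cvg_cst].
suff : (fun x => inner h x - phi h : C^o) @ near_min --> (0 : C^o).
  by move=> /(cvgC_unique cv)->.
apply/cvgrPdist_lt => _ /posC[e e0 ->].
have [r r0 rE] := posC h0.
exists (e ^+ 2 / (r *+ 2)) => /=; first by rewrite divr_gt0 ?exprn_gt0 ?mulrn_wgt0.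
move=> x /= xe; rewrite sub0r normrN.
have eC : 0 < e%:C by rewrite ltcR.
rewrite -ltr_sqr ?nnegrE ?(ltW eC)//.
apply: le_lt_trans (key _ _ xe) _; rewrite rE -rmorphM -rmorphXn/= ltcR.
have -> : e ^+ 2 / (r *+ 2) * r = e ^+ 2 / 2 by field; rewrite gt_eqF.
have : 0 < e ^+ 2 by rewrite exprn_gt0.
lra.
Qed.

End Riesz.
End Inner.

(** The form for a bare function, to be used where no bundled linear map is
    at hand. *)
Lemma riesz_functional (R : realType) (H : hilbertType R) (phi : H ->
  R[i]^o) (M : R[i]) :
  linear phi -> (forall x, `|phi x| <= M * `|x|) ->
  exists z, forall x, phi x = inner x z.
Proof.
move=> lphi phiM.
pose L := GRing.isLinear.Build R[i] H R[i]^o *:%R phi lphi.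
pose f : {linear H -> R[i]^o} := HB.pack phi L.
exact: (@riesz _ _ f M phiM).
Qed.

Section Adjoint.
Variables (R : realType) (H K : hilbertType R).
Implicit Types (T : bop H K) (S : bop K H).

(** Riesz gives S y for each y; uniqueness of the representing vector makes
    S linear, and |S y|^2 = <T (S y), y> bounds it. *)
Lemma adjoint_exists T : exists S : bop K H,
  forall x y, inner (T x) y = inner x (S y).
Proof.
have [M TM] := bop_ge0_bounded T.
have /choice[s sP] : forall y, exists z, forall x, inner (T x) y = inner x z.
  move=> y; apply: (@riesz_functional _ _ (fun x => inner (T x) y) (`|M| * `|y|)).
    by move=> a u v; rewrite linearP innerDl innerZl.
  move=> x; rewrite mulrAC (le_trans (inner_CS _ _))//.
  by rewrite ler_wpM2r.
have ls : linear s.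
  move=> a u v; apply: inner_ext => z.
  rewrite inner_conj -sP innerDr innerZr innerDl innerZl.
  by rewrite [inner (s u) z]inner_conj [inner (s v) z]inner_conj -!sP rmorphD
    rmorphM/= conjCK.
pose L := GRing.isLinear.Build R[i] K H *:%R s ls.
pose f : {linear K -> H} := HB.pack s L.
have fb : exists M : R[i], forall x, `|f x| <= M * `|x|.
  exists `|M| => y; suff : `|s y| <= `|M| * `|y| by [].
  have [->|sy0] := eqVneq (s y) 0.
    by rewrite normr0 mulr_ge0.
  rewrite -(ler_pM2l (_ : 0 < `|s y|)) ?normr_gt0// -expr2 -inner_norm -sP.
  rewrite -[inner _ _]ger0_norm; last by rewrite sP inner_norm exprn_ge0.
  rewrite (le_trans (inner_CS _ _))// mulrA ler_wpM2r// mulrC.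
  exact: TM.
by exists (Bop fb).
Qed.

Lemma adjointP T x y : inner (T x) y = inner x (adjoint T y).
Proof.
rewrite /adjoint; case: xgetP => [S _ -> //|] h.
by have [S SP] := adjoint_exists T; have := h S SP.
Qed.

Lemma adjointP' T x y : inner (adjoint T y) x = inner y (T x).
Proof. by rewrite inner_conj -adjointP -inner_conj. Qed.

Lemma adjoint_eq T (s : K -> H) :
  (forall x y, inner (T x) y = inner x (s y)) -> adjoint T =1 s.
Proof.
move=> Ts y; apply: inner_ext => x.
by rewrite adjointP' inner_conj Ts -inner_conj.
Qed.

End Adjoint.

(** * Density of linear spans, and orthogonal complements *)

Section Density.
Variables (R : realType) (H : hilbertType R).
Implicit Types (A : set H).

Lemma denseP (S : set H) :
  dense S <-> forall v (e : R[i]), 0 < e -> exists2 s, S s & `|v - s| < e.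
Proof.
split=> [dS v e e0|dS O [v Ov] oO].
  have /(_ (ball v e)) := dS.
  case; [by exists v; exact: ballxx|exact: ball_open|].
  by move=> s [/= vs Ss]; exists s => //; move: vs; rewrite -ball_normE.
have : nbhs v O by move: oO; rewrite openE; exact.
rewrite -nbhs_ballE => -[e /= e0 veO].
have [s Ss vs] := dS v e e0; exists s; split => //.
by apply: veO; rewrite -ball_normE.
Qed.

Lemma dense_ext (S : set H) (K : hilbertType R) (A B : bop H K) :
  dense (lin_span S) -> (forall s, S s -> A s = B s) -> A =1 B.
Proof.
move=> /denseP dS AB v.
have AB' s : lin_span S s -> A s = B s.
  move=> [n [c [w [Sw ->]]]]; rewrite !linear_sum; apply: eq_bigr => k _.
  by rewrite !linearZ/= AB.
have [M AM] := bop_ge0_bounded A; have [N BN] := bop_ge0_bounded B.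
apply/eqP; rewrite -subr_eq0 -normr_eq0; apply/eqP.
apply/eqP; rewrite eq_le normr_ge0 andbT.
apply/ler_addgt0Pl => e e0; rewrite addr0.
have MN0 : 0 < `|M| + `|N| + 1 by rewrite ltr_wpDl// addr_ge0.
have [|s /AB' ABs vs] := dS v (e / (`|M| + `|N| + 1)); first by rewrite divr_gt0.
have -> : A v - B v = A (v - s) - B (v - s).
  by rewrite (raddfB A) (raddfB B)/= ABs opprB addrA subrK.
rewrite (le_trans (ler_normB _ _))//.
apply: (@le_trans _ _ ((`|M| + `|N| + 1) * `|v - s|)).
  by rewrite !mulrDl -addrA lerD// -[X in X <= _]addr0 lerD// mul1r.
by rewrite mulrC -ler_pdivlMr// ltW.
Qed.

Section SpanClosure.
Variable A : set H.

Let cl : set H :=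
  [set v | forall e : R[i], 0 < e -> exists2 s, lin_span A s & `|v - s| < e].

Lemma lin_span_submod a x y :
  lin_span A x -> lin_span A y -> lin_span A (a *: x + y).
Proof.
move=> [m [c [v [Av ->]]]] [n [d [w [Aw ->]]]].
exists (m + n)%N,
  (fun k => match fintype.split k with inl i => a * c i | inr j => d j end).
exists (fun k => match fintype.split k with inl i => v i | inr j => w j end); split.
  by move=> k; case: fintype.split.
rewrite big_split_ord/= scaler_sumr; congr (_ + _); apply: eq_bigr => k _.
  by rewrite -[lshift _ _]/(unsplit (inl k)) unsplitK scalerA.
by rewrite -[rshift _ _]/(unsplit (inr k)) unsplitK.
Qed.

Lemma lin_span0 : lin_span A 0.
Proof.
exists 0%N, (fun=> 0), (fun=> 0); split; first by case.
by rewrite big_ord0.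
Qed.

Lemma lin_span_gen x : A x -> lin_span A x.
Proof.
move=> Ax; exists 1%N, (fun=> 1), (fun=> x); split => //.
by rewrite big_ord1 scale1r.
Qed.

Let cl_submod : submod_closed (mem cl).
Proof.
split=> [|a x y]; first by rewrite in_setE => e e0; exists 0;
  [exact: lin_span0|rewrite subrr normr0].
rewrite !in_setE => cx cy e e0.
have a0 : 0 < `|a| + 1 by rewrite ltr_wpDl.
have [|s As xs] := cx (e / 2 / (`|a| + 1)); first by rewrite !divr_gt0.
have [|t At yt] := cy (e / 2); first by rewrite !divr_gt0.
exists (a *: s + t); first exact: lin_span_submod.
rewrite opprD addrACA -scalerBr (le_lt_trans (ler_normD _ _))//.
rewrite [ltRHS]splitr ler_ltD// normrZ.
apply: (@le_trans _ _ ((`|a| + 1) * `|x - s|)).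
  by rewrite ler_wpM2r// lerDl.
by rewrite mulrC -ler_pdivlMr// ltW.
Qed.

Let cl_closed : closed cl.
Proof.
move=> x xc e e0; have e2 : 0 < e / 2 by rewrite divr_gt0.
have /xc [y [cy xy]] : nbhs x (ball x (e / 2)) by exact: nbhsx_ballx.
have [s As ys] := cy _ e2; exists s => //.
rewrite -(subrK y x) -addrA (le_lt_trans (ler_normD _ _))//.
by rewrite [ltRHS]splitr ltrD//; move: xy; rewrite -ball_normE.
Qed.

Let K := ClosedSubspace cl_submod cl_closed.

(** The closed span K of A is a Hilbert space. The functional k |-> <k, v> on K
    is represented by some z in K, so v - z is orthogonal to A; if that forces
    v = z, then v lies in K. *)
Lemma total_dense : (forall v, (forall a, A a -> inner v a = 0) -> v = 0) ->
  dense (lin_span A).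
Proof.
move=> tA; apply/denseP => v; suff : cl v by [].
have [||z zP] := @riesz_functional _ (cs_type K) (fun k => inner (val k) v) `|v|.
- by move=> a x y; rewrite raddfD/= innerDl innerZl.
- by move=> x; rewrite mulrC cs_norm (le_trans (inner_CS _ _)).
suff -> : v = val z; first exact: (set_mem (cs_valP z)).
apply/eqP; rewrite -subr_eq0; apply/eqP/tA => a Aa.
have ca : cl a by move=> e e0; exists a; [exact: lin_span_gen|rewrite subrr normr0].
have := zP (CsType (mem_set ca : a \in cs_pred K)) => /= h.
by apply: inner_eq0C; rewrite innerBr h subrr.
Qed.

End SpanClosure.
End Density.

Section OrthogonalComplement.
Variables (R : realType) (H : hilbertType R).
Implicit Types (A : set H) (x y : H).

Definition perp A : set H := [set x | forall u, A u -> inner x u = 0].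

Lemma perp_submod A : submod_closed (mem (perp A)).
Proof.
split=> [|a x y]; first by rewrite in_setE => u _; rewrite inner0l.
rewrite !in_setE => Ax Ay u Au.
by rewrite innerDl innerZl Ax// Ay// mulr0 addr0.
Qed.

Lemma perp_closed A : closed (perp A).
Proof.
move=> x xA u Au.
suff : `|inner x u| = 0 by move/eqP; rewrite normr_eq0 => /eqP.
apply/eqP; rewrite eq_le normr_ge0 andbT.
apply/ler_addgt0Pl => e e0; rewrite addr0.
have u0 : 0 < `|u| + 1 by rewrite ltr_wpDl.
have /xA [y [Ay /= xy]] : nbhs x (ball x (e / (`|u| + 1))).
  by apply: nbhsx_ballx; rewrite divr_gt0.
rewrite -[inner x u]subr0 -(Ay u Au) -innerBl (le_trans (inner_CS _ _))//.
move: xy; rewrite -ball_normE/= ltr_pdivlMr// => /ltW; apply: le_trans.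
by rewrite ler_wpM2l// lerDl.
Qed.

Definition perp_space A : closedSubspace H :=
  ClosedSubspace (perp_submod A) (@perp_closed A).

Lemma sub_biperp A x : A x -> perp (perp A) x.
Proof. by move=> Ax u /(_ x Ax); exact: inner_eq0C. Qed.

(** The double complement of A plays the part of the closed span of A. Equalities
    between self-adjoint maps pass to it by testing f z - g z, which is
    orthogonal to A, instead of by continuity. *)
Lemma biperp_eq A (f g : H -> H) x :
  (forall x y, inner (f x) y = inner x (f y)) ->
  (forall x y, inner (g x) y = inner x (g y)) ->
  (forall a, A a -> f a = g a) -> perp (perp A) x -> f x = g x.
Proof.
move=> fsa gsa fg xA; apply: inner_ext => z; rewrite fsa gsa.
apply/eqP; rewrite -subr_eq0 -innerBr; apply/eqP/xA => a Aa.
by rewrite innerBl fsa gsa fg// subrr.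
Qed.

Lemma biperp_total A x : perp (perp A) x ->
  (forall a, A a -> inner x a = 0) -> x = 0.
Proof. by move=> xA x0; apply/inner_xx_eq0/xA. Qed.

End OrthogonalComplement.

(** * Unconditional sums and orthogonal series *)

Section FsetSums.
Variables (R : realType) (X : choiceType).
Local Notation C := (R[i]).
Implicit Types (A B : {fset X}).

Lemma big_fset_subset (V : zmodType) A B (F : X -> V) : (A `<=` B)%fset ->
  \sum_(x <- B) F x = \sum_(x <- A) F x + \sum_(x <- (B `\` A)%fset) F x.
Proof.
move=> AB; rewrite (big_fsetID _ (mem A) B)/=; congr (_ + _).
  by apply: eq_fbigl => x; rewrite !inE /=; apply: andb_idl; exact: (fsubsetP AB).
by apply: eq_fbigl => x; rewrite !inE /= andbC.
Qed.

(** An unconditional sum may be computed along any exhausting sequence of finite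
    sets; boxes will be used for sums over multi-indices. *)
Lemma csum_cofinal (a : X -> C) (B : nat -> {fset X}) : abs_summable a ->
  (forall A, exists N, forall n, (N <= n)%N -> (A `<=` B n)%fset) ->
  (fun n => \sum_(x <- B n) a x : C^o) @ \oo --> (csum a : C^o).
Proof.
move=> sa cB; have Bt : B @ \oo --> @totally X.
  move=> U [A _ AU]; have [N NB] := cB A.
  by exists N => // n /= /NB; exact: AU.
have := @cvg_comp _ _ _ B (partial_sum (a : X -> C^o)) _ _ _ Bt (abs_summable_cvg sa).
apply: cvg_trans.
by apply: near_eq_cvg; apply: nearW => n /=; rewrite partial_sumE.
Qed.

Lemma l2_inner_delta (f : l2 R X) x : inner f (l2_delta R x) = f x.
Proof.
have cv := abs_summable_cvg (l2_inner_summable f (l2_delta R x)).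
apply: (cvgC_unique cv); apply: cvg_near_cst; exists [fset x]%fset => //= A xA.
rewrite partial_sumE (big_fset_subset _ xA) big_seq_fset1.
rewrite /= /l2_delta_fun eqxx rmorph1 mulr1 big_seq big1 ?addr0// => y.
by rewrite !inE => /andP[/negbTE-> _]; rewrite rmorph0 mulr0.
Qed.

Lemma l2_deltas_total (f : l2 R X) :
  (forall x, inner f (l2_delta R x) = 0) -> f = 0.
Proof.
by move=> fd; apply/val_inj/funext => x; rewrite /= -l2_inner_delta fd.
Qed.

(** Pythagoras: the partial sums are as far apart as those of the convergent
    series of the c |f x|^2. *)
Lemma orthogonal_series (H : hilbertType R) (w : X -> H) (c : C) (f : l2 R X) :
  0 <= c -> (forall x y, inner (w x) (w y) = if x == y then c else 0) ->
  exists v : H, (fun A : {fset X} => \sum_(x <- A) f x *: w x : H) @ totally --> v.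
Proof.
move=> c0 wP.
have normS A : `|\sum_(x <- A) f x *: w x| ^+ 2 = (\sum_(x <- A) `|f x| ^+ 2) * c.
  rewrite -inner_norm inner_suml mulr_suml; apply: eq_big_seq => x xA.
  rewrite inner_sumr (big_fsetD1 x xA)/= big_seq big1 ?addr0.
    by rewrite innerZl innerZr wP eqxx mulrA -normCK.
  move=> y; rewrite !inE => /andP[yx _].
  by rewrite innerZl innerZr wP eq_sym (negbTE yx) !mulr0.
suff : cvg ((fun A : {fset X} => \sum_(x <- A) f x *: w x : H) @ totally).
  move=> ?.
  by exists (lim ((fun A : {fset X} => \sum_(x <- A) f x *: w x : H) @ totally)).
apply: cauchy_cvg; apply: cauchy_exP => e e0.
have := abs_summable_cvg (square_summableP (l2_sq f)).
set L := csum _ => /(@cvgrPdist_lt _ C^o) cv.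
have d0 : 0 < e ^+ 2 / 2 / (c + 1) by rewrite !divr_gt0 ?exprn_gt0// ltr_wpDl.
have [A0 _ A0P] := cv _ d0.
exists (\sum_(x <- A0) f x *: w x), A0 => //= B A0B; rewrite -ball_normE/=.
rewrite (big_fset_subset _ A0B) opprD addNKr normrN -ltr_sqr ?nnegrE// ?ltW//.
rewrite normS; set s := \sum_(x <- _) _.
have s0 : 0 <= s by apply: sumr_ge0 => x _; rewrite exprn_ge0.
have sE : s = (L - partial_sum (fun x => `|f x| ^+ 2 : C^o) A0) -
              (L - partial_sum (fun x => `|f x| ^+ 2 : C^o) B).
  have -> : partial_sum (fun x => `|f x| ^+ 2 : C^o) B =
      partial_sum (fun x => `|f x| ^+ 2 : C^o) A0 + s.
    by rewrite !partial_sumE (big_fset_subset _ A0B).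
  by rewrite opprB addrC addrA subrK addrAC subrr add0r.
have : s < e ^+ 2 / (c + 1).
  rewrite -[s]ger0_norm// sE (le_lt_trans (ler_normB _ _))//.
  have -> : e ^+ 2 / (c + 1) = e ^+ 2 / 2 / (c + 1) + e ^+ 2 / 2 / (c + 1).
    by field; rewrite gt_eqF// ltr_wpDl.
  by apply: ltrD; [exact: (A0P A0 (fsubset_refl _))|exact: (A0P B A0B)].
rewrite ltr_pdivlMr ?ltr_wpDl//; apply: le_lt_trans.
by rewrite ler_wpM2l// lerDl.
Qed.

End FsetSums.

(** * Power partial isometries *)

Section Iterates.
Variables (R : realType) (H : hilbertType R).
Implicit Types (A B : bop H H) (x y : H).

Lemma bop_expE A n x : bop_exp A n x = iter n A x.
Proof. by elim: n => //= n ->. Qed.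

Lemma iter_linear A n : linear (iter n A).
Proof. by move=> a x y; rewrite -!bop_expE linearP. Qed.

Lemma iter_sub A n x y : iter n A (x - y) = iter n A x - iter n A y.
Proof. by rewrite -!bop_expE raddfB. Qed.

Lemma iter_zero A n : iter n A 0 = 0.
Proof. by rewrite -bop_expE raddf0. Qed.

Lemma iter_adj A B : (forall x y, inner (A x) y = inner x (B y)) ->
  forall n x y, inner (iter n A x) y = inner x (iter n B y).
Proof. by move=> AB; elim=> // n IH x y; rewrite iterS AB IH -iterSr. Qed.

Lemma iter_comm (f g : H -> H) : (forall x, f (g x) = g (f x)) ->
  forall n x, iter n f (g x) = g (iter n f x).
Proof. by move=> fg; elim=> //= n IH x; rewrite IH fg. Qed.

(** From |A B u| = |B u| and |B w| <= |w| one gets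
    |B u - B A B u|^2 <= |B u|^2 - 2 |A B u|^2 + |A B u|^2 = 0. *)
Lemma partial_isometry_regular A B :
  (forall x y, inner (A x) y = inner x (B y)) -> partial_isometry A ->
  (forall x, A (B (A x)) = A x) /\ (forall x, B (A (B x)) = B x).
Proof.
move=> AB pA.
have BA x y : inner (B x) y = inner x (A y) by rewrite inner_conj -AB -inner_conj.
have nAB u : `|A (B u)| = `|B u|.
  by apply: pA => y Ay; rewrite BA Ay inner0r.
have nB u : `|B u| <= `|u|.
  have [->|Bu0] := eqVneq (B u) 0; first by rewrite normr0.
  rewrite -(ler_pM2l (_ : 0 < `|B u|)) ?normr_gt0// -expr2 -inner_norm BA.
  by rewrite -nAB mulrC -[inner _ _]ger0_norm ?inner_CS// -BA inner_norm exprn_ge0.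
have BAB u : B (A (B u)) = B u.
  apply/esym/eqP; rewrite -subr_eq0 -normr_eq0 -sqrf_eq0 eq_le exprn_ge0// andbT.
  have e1 : inner (B u) (B (A (B u))) = `|B u| ^+ 2 by rewrite -AB inner_norm nAB.
  have e2 : inner (B (A (B u))) (B u) = `|B u| ^+ 2 by rewrite BA inner_norm nAB.
  rewrite normB_sq e1 e2 opprD addrA (addrC (`|B u| ^+ 2)) addrK subr_le0.
  by rewrite ler_sqr ?nnegrE// -[leRHS]nAB.
by split=> // x; apply: inner_ext => z; rewrite AB BA !AB BAB.
Qed.

Section Projections.
Variables p q : H -> H.
Hypothesis p_sa : forall x y, inner (p x) y = inner x (p y).
Hypothesis p_id : forall x, p (p x) = p x.
Hypothesis q_sa : forall x y, inner (q x) y = inner x (q y).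
Hypothesis q_id : forall x, q (q x) = q x.

Lemma projection_pythagoras (r : H -> H) x :
  (forall x y, inner (r x) y = inner x (r y)) -> (forall x, r (r x) = r x) ->
  `|x - r x| ^+ 2 = `|x| ^+ 2 - `|r x| ^+ 2.
Proof.
move=> rsa rid; have xr : inner x (r x) = inner (r x) (r x) by rewrite rsa rid.
by rewrite normB_sq (rsa x x) xr inner_norm; ring.
Qed.

Lemma projection_le (r : H -> H) x :
  (forall x y, inner (r x) y = inner x (r y)) -> (forall x, r (r x) = r x) ->
  `|r x| <= `|x|.
Proof.
move=> rsa rid; rewrite -ler_sqr ?nnegrE// -subr_ge0.
by rewrite -projection_pythagoras// exprn_ge0.
Qed.

(** If q p is idempotent, then for y in its range |y| = |q p y| <= |p y| <= |y|, so
    p y = y. Hence p q p = q p, whose left-hand side is self-adjoint. *)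
Lemma projections_commute : (forall x, q (p (q (p x))) = q (p x)) ->
  forall x, p (q x) = q (p x).
Proof.
move=> qpqp.
have pqp x : p (q (p x)) = q (p x).
  set y := q (p x).
  apply/esym/eqP; rewrite -subr_eq0 -normr_eq0 -sqrf_eq0 eq_le exprn_ge0// andbT.
  rewrite projection_pythagoras// subr_le0 ler_sqr ?nnegrE//.
  by rewrite -{1}[y]qpqp projection_le.
by move=> x; apply: inner_ext => z; rewrite p_sa q_sa -pqp -p_sa -q_sa -p_sa pqp.
Qed.
End Projections.

(** For B = A' this is A^n A'^n. When A is a power partial isometry, it is the
    projection onto the range of A^n; exchanging A and B gives the projection
    onto the initial space of A^n. *)
Definition range_proj (A B : H -> H) n x := iter n A (iter n B x).

(** A power partial isometry together with its adjoint, in a form symmetric under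
    exchange of the two: each fact about T then yields one about T'. *)
Record ppi_pair (A B : bop H H) : Prop := PpiPair {
  pair_adj : forall x y, inner (A x) y = inner x (B y);
  pair_reg : forall n x, range_proj A B n (iter n A x) = iter n A x;
  pair_reg' : forall n x, range_proj B A n (iter n B x) = iter n B x;
  pair_comm : forall n k x,
    range_proj A B n (range_proj B A k x) = range_proj B A k (range_proj A B n x)
}.

Lemma ppi_pair_sym A B : ppi_pair A B -> ppi_pair B A.
Proof.
case=> adj reg reg' comm; split => // x y.
by rewrite inner_conj -adj -inner_conj.
Qed.

(** The two projections commute because
    A^(k+n) A'^(k+n) A^(k+n) = A^(k+n) makes the product Q_k P_n idempotent. *)
Lemma power_partial_isometry_pair A : power_partial_isometry A ->
  ppi_pair A (adjoint A).
Proof.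
move=> pA; set B := adjoint A.
have AB : forall x y, inner (A x) y = inner x (B y) by exact: adjointP.
have BA : forall x y, inner (B x) y = inner x (A y) by move=> x y; rewrite adjointP'.
have regs n : (forall x, range_proj A B n (iter n A x) = iter n A x) /\
              (forall x, range_proj B A n (iter n B x) = iter n B x).
  have [|rA rB] := @partial_isometry_regular (bop_exp A n) (bop_exp B n) _ (pA n).
    by move=> x y; rewrite !bop_expE; exact: iter_adj.
  by split=> x; [have := rA x|have := rB x]; rewrite !bop_expE.
have rA n := (regs n).1; have rB n := (regs n).2.
split=> // n k x; apply: projections_commute => {x}.
- by move=> x y; rewrite /range_proj (iter_adj AB) (iter_adj BA).
- by move=> x; rewrite {2}/range_proj rA.
- by move=> x y; rewrite /range_proj (iter_adj BA) (iter_adj AB).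
- by move=> x; rewrite {2}/range_proj rB.
- move=> x; have := rA (k + n)%N (iter n B x); rewrite /range_proj.
  by rewrite {2}[(k + n)%N]addnC !iterD => ->.
Qed.

End Iterates.

(** * The cells of a power partial isometry *)

Section Cells.
Variables (R : realType) (H : hilbertType R).
Implicit Types (A B : bop H H) (c d : option nat) (w x y : H).

(** The pieces into which the decreasing projections P_n divide the space:
    Some a is the range of P_a - P_(a+1), and None is the intersection of all
    the ranges. Written as equations, they need no limit projection. *)
Definition cut (A B : H -> H) c w : Prop :=
  if c is Some a then range_proj A B a w = w /\ range_proj A B a.+1 w = 0
  else forall n, range_proj A B n w = w.

Definition cell (A B : H -> H) c d w : Prop := cut A B c w /\ cut B A d w.

Lemma cell_sym (A B : H -> H) c d w : cell A B c d w -> cell B A d c w.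
Proof. by case. Qed.

Lemma range_proj_linear A B n : linear (range_proj A B n).
Proof. by move=> a x y; rewrite /range_proj !iter_linear. Qed.

Lemma range_proj_sub A B n x y :
  range_proj A B n (x - y) = range_proj A B n x - range_proj A B n y.
Proof. by rewrite /range_proj !iter_sub. Qed.

Lemma range_proj_zero A B n : range_proj A B n 0 = 0.
Proof. by rewrite /range_proj !iter_zero. Qed.

Lemma cut_linear A B c a x y : cut A B c x -> cut A B c y -> cut A B c (a *: x + y).
Proof.
case: c => [k|] /= => [[x1 x0] [y1 y0]|xP yP].
  by rewrite !range_proj_linear x1 y1 x0 y0 scaler0 addr0.
by move=> n; rewrite range_proj_linear xP yP.
Qed.

Lemma cut_zero A B c : cut A B c 0.
Proof.
by case: c => [k|]/=; [rewrite !range_proj_zero|move=> n; rewrite range_proj_zero].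
Qed.

Lemma cut_image A B c (C : H -> H) w : C 0 = 0 ->
  (forall n x, range_proj A B n (C x) = C (range_proj A B n x)) ->
  cut A B c w -> cut A B c (C w).
Proof.
move=> C0 CP; case: c => [k|] /= => [[w1 w0]|wP].
  by rewrite !CP w1 w0.
by move=> n; rewrite CP wP.
Qed.

Section Pair.
Variables (A B : bop H H).
Hypothesis AB : ppi_pair A B.

Lemma range_proj_self_adjoint n x y :
  inner (range_proj A B n x) y = inner x (range_proj A B n y).
Proof.
have BA := pair_adj (ppi_pair_sym AB).
by rewrite /range_proj (iter_adj (pair_adj AB)) (iter_adj BA).
Qed.

Lemma range_proj_absorb k n x : (k <= n)%N ->
  range_proj A B k (range_proj A B n x) = range_proj A B n x.
Proof.
move=> kn; rewrite [range_proj A B n x]/range_proj -(subnKC kn) iterD.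
by rewrite (pair_reg AB).
Qed.

Lemma range_proj_idem n x :
  range_proj A B n (range_proj A B n x) = range_proj A B n x.
Proof. exact: range_proj_absorb. Qed.

Lemma range_proj_eq_le k n x : (k <= n)%N -> range_proj A B n x = x ->
  range_proj A B k x = x.
Proof. by move=> kn nx; rewrite -nx range_proj_absorb. Qed.

(** If a comes before the other index, then P_(a+1) kills w and fixes w'. *)
Lemma cut_orthogonal c d w w' : cut A B c w -> cut A B d w' -> c <> d ->
  inner w w' = 0.
Proof.
wlog : c d w w' / (if c is Some a then
    if d is Some b then (a < b)%N else true else false).
  move=> wl; case: c d => [a|] [b|] cw dw cd.
  - have : a <> b by move=> ab; apply: cd; rewrite ab.
    move/eqP; rewrite neq_ltn => /orP[ab|ba].
      exact: (wl (Some a) (Some b)).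
    by apply: inner_eq0C; apply: (wl (Some b) (Some a)) => // /esym.
  - exact: (wl (Some a) None).
  - by apply: inner_eq0C; apply: (wl (Some b) None) => // /esym.
  - by [].
case: c => // a; case: d => [b ab|_] [w1 w0].
- move=> [w'1 _] _; rewrite -(range_proj_eq_le ab w'1) -range_proj_self_adjoint w0.
  exact: inner0l.
- move=> w'P _; rewrite -(w'P a.+1) -range_proj_self_adjoint w0.
  exact: inner0l.
Qed.

Lemma cell_kill c w : cell A B c (Some 0%N) w -> A w = 0.
Proof.
by move=> [_ [_ w0]]; rewrite -[A w](pair_reg AB 1%N) /range_proj/= in w0 *;
  rewrite w0 raddf0.
Qed.

(** The condition on d makes A' A w = w. Then P_(n+1) A w = A P_n w, and
    Q_n A w = A Q_(n+1) w because Q_n commutes with P_1. *)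
Lemma cell_shift c d w : cell A B c (omap succn d) w ->
  cell A B (omap succn c) d (A w) /\ B (A w) = w.
Proof.
move=> [cw dw]; have BAw : B (A w) = w.
  case: d dw => [b|] /= => [[w1 _]|wP]; last exact: (wP 1%N).
  by rewrite -w1 {1 2}/range_proj iterS; exact: (pair_reg' AB 1%N).
have PA n : range_proj A B n.+1 (A w) = A (range_proj A B n w).
  by rewrite /range_proj [iter n.+1 B _]iterSr BAw.
have QA n : range_proj B A n (A w) = A (range_proj B A n.+1 w).
  have := pair_comm AB 1 n (A w); rewrite /range_proj/= BAw => <-.
  by rewrite -iterSr iterS.
split=> //; split.
  case: c cw => [a|] /= => [[w1 w0]|wP]; first by rewrite !PA w1 w0 raddf0.
  by case=> // n; rewrite PA wP.
case: d dw => [b|] /= => [[w1 w0]|wP]; first by rewrite !QA w1 w0 raddf0.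
by move=> n; rewrite QA wP.
Qed.

(** If some P_n v differs from v, take the first one, n = a + 1; then v = P_a v,
    and v - P_(a+1) v is a nonzero vector of the piece a. Since N is arbitrary,
    the vector found keeps any property that the P_n preserve. *)
Lemma cut_exists (N : set H) v :
  (forall n x, N x -> N (range_proj A B n x)) ->
  (forall x y, N x -> N y -> N (x - y)) ->
  N v -> v <> 0 -> exists c w, [/\ N w, w <> 0 & cut A B c w].
Proof.
move=> Nrp Nsub Nv v0.
have [vP|] := pselect (forall n, range_proj A B n v = v); first by exists None, v.
move=> /existsNP[n0 n0v].
have ex : exists n, `[< range_proj A B n v <> v >] by exists n0; apply/asboolP.
have := ex_minnP ex; case: ex_minnP => n /asboolP nv nmin _.
case: n nv nmin => [//|a] av amin.
have av' : range_proj A B a v = v.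
  apply: contrapT => h; have := amin a; rewrite ltnn => /(_ _)/notF; apply.
  exact/asboolP.
(* As v = P_a v, the difference v - P_(a+1) v lies in the range of P_a. *)
exists (Some a), (v - range_proj A B a.+1 v); split.
- by apply: Nsub => //; exact: Nrp.
- by move/eqP; rewrite subr_eq0 => /eqP/esym.
- by rewrite /= !range_proj_sub av' range_proj_absorb// range_proj_idem subrr.
Qed.

End Pair.

Lemma cell_exists A B (N : set H) v : ppi_pair A B ->
  (forall x, N x -> N (A x)) -> (forall x, N x -> N (B x)) ->
  (forall x y, N x -> N y -> N (x - y)) -> N v -> v <> 0 ->
  exists c d w, [/\ N w, w <> 0 & cell A B c d w].
Proof.
move=> AB NA NB Nsub Nv v0; have BA := ppi_pair_sym AB.
have Nit (f : H -> H) n x : (forall x, N x -> N (f x)) -> N x -> N (iter n f x).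
  by move=> Nf Nx; elim: n => //= n; exact: Nf.
have [|d [w [Nw w0 dw]]] := cut_exists BA (N := N) _ Nsub Nv v0.
  by move=> n x Nx; rewrite /range_proj; apply: (Nit B n) => //; exact: (Nit A n).
have [|||c [u [[Nu du] u0 cu]]] :=
  cut_exists AB (N := [set x | N x /\ cut B A d x]) (v := w) _ _ _ w0 => //.
- move=> n x [Nx dx]; split.
    by rewrite /range_proj; apply: (Nit A n) => //; exact: (Nit B n).
  apply: cut_image dx; first exact: range_proj_zero.
  by move=> k y; rewrite (pair_comm AB).
- move=> x y [Nx dx] [Ny dy]; split; first exact: Nsub.
  by rewrite addrC -scaleN1r; exact: cut_linear.
- by exists c, d, u.
Qed.

End Cells.

(** * Labels as orbits of cells *)

(** The orbits of (c, d + 1) |-> (c + 1, d) on pairs of extended naturals, with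
    None as infinity. The label is the orbit; k numbers its cells along the
    motion of A for the labels s and p, and along the motion of A' for b. *)
Definition label_cuts (l : label) (k : nat) : option nat * option nat :=
  match l with
  | lab_u => (None, None)
  | lab_s => (Some k, None)
  | lab_b => (None, Some k)
  | lab_fin p _ => (Some k, Some (p.-1 - k)%N)
  end.

Definition valid (l : label) (k : nat) : bool :=
  match l with
  | lab_u => k == 0%N
  | lab_fin p _ => (k < p)%N
  | _ => true
  end.

Lemma valid0 l : valid l 0.
Proof. by case: l. Qed.

Lemma label_cuts_inj l k l' k' : valid l k -> valid l' k' ->
  label_cuts l k = label_cuts l' k' -> l = l' /\ k = k'.
Proof.
case: l => [|||p p0]; case: l' => [|||q q0] //=.
- by move=> /eqP-> /eqP->.
- by move=> _ _ [->].
- by move=> _ _ [->].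
move=> kp kq [] kk; rewrite -{}kk in kq * => pq.
have pE : p = q.
  rewrite -(prednK p0) -(prednK q0); congr _.+1.
  by rewrite -(@subnK k p.-1) ?pq ?subnK// -ltnS prednK.
by move: p0 {kp pq}; rewrite {p}pE => p0; rewrite (bool_irrelevance p0 q0).
Qed.

(** A finite pair (a, b) lies on the chain of length a + b + 1. *)
Lemma label_cuts_surj c d : exists l k, valid l k /\ label_cuts l k = (c, d).
Proof.
case: c d => [a|] [b|].
- exists (@lab_fin (a + b).+1 isT), a; rewrite /= ltnS leq_addr; split => //.
  by rewrite addKn.
- by exists lab_s, a.
- by exists lab_b, b.
- by exists lab_u, 0%N.
Qed.

(** * Joint cells of a star-commuting family *)

Section Family.
Variables (R : realType) (H : hilbertType R) (M : nat) (T : 'I_M -> bop H H).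
Hypothesis sc : star_commuting T.
Hypothesis pT : forall m, power_partial_isometry (T m).

Local Notation Ts := (fun m => adjoint (T m)).

Lemma pairT m : ppi_pair (T m) (Ts m).
Proof. exact: power_partial_isometry_pair. Qed.

Lemma pairTs m : ppi_pair (Ts m) (T m).
Proof. exact/ppi_pair_sym/pairT. Qed.

Lemma commTT m n x : T m (T n x) = T n (T m x).
Proof. exact: sc.1. Qed.

Lemma commST m n x : m <> n -> Ts m (T n x) = T n (Ts m x).
Proof. by move=> mn; exact: sc.2. Qed.

Lemma commSS m n x : Ts m (Ts n x) = Ts n (Ts m x).
Proof.
by apply: inner_ext => z; rewrite !adjointP' commTT.
Qed.

Definition label_cell m l k (w : H) :=
  cell (T m) (Ts m) (label_cuts l k).1 (label_cuts l k).2 w.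

(** The operator that raises the position: T m, or its adjoint on backward
    shifts; bwd is its adjoint. *)
Definition fwd (l : label) m : bop H H := if l is lab_b then Ts m else T m.
Definition bwd (l : label) m : bop H H := if l is lab_b then T m else Ts m.

Lemma fwd_adj l m x y : inner (fwd l m x) y = inner x (bwd l m y).
Proof. by case: l => [|||p p0]; first [exact: adjointP|exact: adjointP']. Qed.

Lemma label_cell_zero m l k : label_cell m l k 0.
Proof. by split; exact: cut_zero. Qed.

Lemma label_cell_comm m l k (C : H -> H) w : C 0 = 0 ->
  (forall x, T m (C x) = C (T m x)) -> (forall x, Ts m (C x) = C (Ts m x)) ->
  label_cell m l k w -> label_cell m l k (C w).
Proof.
move=> C0 CT CS [c d]; split; apply: cut_image => // n x; rewrite /range_proj.
  by rewrite (iter_comm CS) (iter_comm CT).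
by rewrite (iter_comm CT) (iter_comm CS).
Qed.

Lemma label_cell_T m n l k w : m <> n -> label_cell m l k w ->
  label_cell m l k (T n w).
Proof.
move=> mn; apply: label_cell_comm; first exact: raddf0.
  by move=> x; rewrite commTT.
by move=> x; exact: commST.
Qed.

Lemma label_cell_Ts m n l k w : m <> n -> label_cell m l k w ->
  label_cell m l k (Ts n w).
Proof.
move=> mn; apply: label_cell_comm; first exact: raddf0.
  by move=> x; rewrite commST// => /esym.
by move=> x; exact: commSS.
Qed.

Lemma label_cell_fwd m n l l' k w : m <> n -> label_cell m l k w ->
  label_cell m l k (fwd l' n w).
Proof.
by case: l' => [|||p p0] *;
  [exact: label_cell_T..| exact: label_cell_Ts|exact: label_cell_T].
Qed.

Lemma label_cell_bwd m n l l' k w : m <> n -> label_cell m l k w ->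
  label_cell m l k (bwd l' n w).
Proof.
by case: l' => [|||p p0] *;
  [exact: label_cell_Ts..| exact: label_cell_T|exact: label_cell_Ts].
Qed.

Lemma label_cell_up m l k w : ~~ is_u l -> valid l k.+1 -> label_cell m l k w ->
  label_cell m l k.+1 (fwd l m w) /\ bwd l m (fwd l m w) = w.
Proof.
case: l => [|||p p0] //= _ kp.
- exact: (@cell_shift _ _ _ _ (pairT m) (Some k) None).
- move=> /cell_sym/(@cell_shift _ _ _ _ (pairTs m) (Some k) None)[h ->].
  by split => //; exact: cell_sym.
- rewrite /label_cell/=.
  have -> : (p.-1 - k)%N = (p.-1 - k.+1).+1 by rewrite subnSK// -ltnS prednK.
  exact: (@cell_shift _ _ _ _ (pairT m) (Some k) (Some _)).
Qed.

Lemma label_cell_down m l k w : ~~ is_u l -> valid l k.+1 -> label_cell m l k.+1 w ->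
  label_cell m l k (bwd l m w) /\ fwd l m (bwd l m w) = w.
Proof.
case: l => [|||p p0] //= _ kp.
- move=> /cell_sym/(@cell_shift _ _ _ _ (pairTs m) None (Some k))[h ->].
  by split => //; exact: cell_sym.
- exact: (@cell_shift _ _ _ _ (pairT m) None (Some k)).
- move=> /cell_sym/(@cell_shift _ _ _ _ (pairTs m) (Some _) (Some k))[h ->].
  split => //; rewrite /label_cell/=.
  have -> : (p.-1 - k)%N = (p.-1 - k.+1).+1 by rewrite subnSK// -ltnS prednK.
  exact: cell_sym.
Qed.

Lemma label_cell_bottom m l w : ~~ is_u l -> label_cell m l 0 w -> bwd l m w = 0.
Proof.
case: l => [|||p p0] //= _.
- by move=> /cell_sym/(cell_kill (pairTs m)).
- by move=> /(cell_kill (pairT m)).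
- by move=> /cell_sym/(cell_kill (pairTs m)).
Qed.

Lemma label_cell_top m p p0 w : label_cell m (@lab_fin p p0) p.-1 w -> T m w = 0.
Proof. by rewrite /label_cell/= subnn => /(cell_kill (pairT m)). Qed.

Lemma label_cell_u m w : label_cell m lab_u 0 w ->
  [/\ label_cell m lab_u 0 (T m w), label_cell m lab_u 0 (Ts m w),
      Ts m (T m w) = w & T m (Ts m w) = w].
Proof.
move=> h.
have [h1 h2] := @cell_shift _ _ _ _ (pairT m) None None _ h.
have [h3 h4] := @cell_shift _ _ _ _ (pairTs m) None None _ (cell_sym h).
by split=> //; exact: cell_sym.
Qed.

Lemma label_cell_stable m l k w : valid l k -> label_cell m l k w ->
  (exists2 k', valid l k' & label_cell m l k' (fwd l m w)) /\
  (exists2 k', valid l k' & label_cell m l k' (bwd l m w)).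
Proof.
move=> lk lw; have [lu|lu] := boolP (is_u l).
  case: l lu lk lw => //= _ /eqP-> h; have [h1 h2 _ _] := label_cell_u h.
  by split; exists 0%N.
split.
  have [lk1|lk1] := boolP (valid l k.+1).
    by exists k.+1 => //; have [] := label_cell_up lu lk1 lw.
  exists k => //; suff -> : fwd l m w = 0 by exact: label_cell_zero.
  case: l lu lk lw lk1 => //= p p0 _ kp; rewrite -leqNgt => h pk.
  apply: (@label_cell_top m p p0); suff -> : p.-1 = k by [].
  by rewrite (_ : p = k.+1)//; apply/eqP; rewrite eqn_leq pk kp.
case: k lk lw => [|k] lk lw; last first.
  exists k; first by case: l lk {lu lw} => //= p _; exact: ltnW.
  by have [] := label_cell_down lu lk lw.
exists 0%N; first exact: valid0.
by rewrite (label_cell_bottom lu lw); exact: label_cell_zero.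
Qed.

Lemma label_cell_stable_T m l k w : valid l k -> label_cell m l k w ->
  (exists2 k', valid l k' & label_cell m l k' (T m w)) /\
  (exists2 k', valid l k' & label_cell m l k' (Ts m w)).
Proof. by move=> lk /(label_cell_stable lk) []; case: l {lk} => [|||p p0]. Qed.

Lemma label_cell_orthogonal m l k l' k' w w' : valid l k -> valid l' k' ->
  label_cell m l k w -> label_cell m l' k' w' -> (l, k) <> (l', k') -> inner w w' = 0.
Proof.
move=> lk lk' [cw dw] [cw' dw'] ne.
have : label_cuts l k <> label_cuts l' k'.
  by move=> /label_cuts_inj[]// ll kk; apply: ne; rewrite ll kk.
have [cc|] := pselect ((label_cuts l k).1 = (label_cuts l' k').1); last first.
  by move=> cc _; exact: (cut_orthogonal (pairT m) cw cw').
have [dd|] := pselect ((label_cuts l k).2 = (label_cuts l' k').2); last first.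
  by move=> dd _; exact: (cut_orthogonal (pairTs m) dw dw').
by case; rewrite [label_cuts l k]surjective_pairing cc dd -surjective_pairing.
Qed.

Definition joint_cell (i : 'I_M -> label) (x : 'I_M -> nat) (w : H) :=
  forall m, label_cell m (i m) (x m) w.

(** All the joint cells of the label i together. Their closed span will be the
    summand H_i. *)
Definition label_cells (i : 'I_M -> label) : set H :=
  [set w | exists2 x, forall m, valid (i m) (x m) & joint_cell i x w].

Definition update (x : 'I_M -> nat) m k : 'I_M -> nat :=
  fun n => if n == m then k else x n.

Lemma label_cells_stable i m w : label_cells i w ->
  label_cells i (T m w) /\ label_cells i (Ts m w).
Proof.
move=> [x vx wx]; have [[k vk k1] [k' vk' k1']] := label_cell_stable_T (vx m) (wx m).
split.
  exists (update x m k) => n; rewrite /update; case: eqVneq => [->//|/eqP nm] //.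
  exact: label_cell_T.
exists (update x m k') => n; rewrite /update; case: eqVneq => [->//|/eqP nm] //.
exact: label_cell_Ts.
Qed.

Lemma joint_cell_orthogonal i j x y w w' : (forall m, valid (i m) (x m)) ->
  (forall m, valid (j m) (y m)) -> joint_cell i x w -> joint_cell j y w' ->
  (exists m, (i m, x m) <> (j m, y m)) -> inner w w' = 0.
Proof. by move=> vx vy wx wy [m]; exact: label_cell_orthogonal. Qed.

Lemma label_cells_orthogonal i j w w' : i <> j -> label_cells i w ->
  label_cells j w' -> inner w w' = 0.
Proof.
move=> ij [x vx wx] [y vy wy]; apply: (joint_cell_orthogonal vx vy wx wy).
apply: contrapT => /forallNP h; apply: ij; apply/funext => m.
by have /contrapT[] := h m.
Qed.

(** The subspace N of vectors orthogonal to all joint cells is stable under all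
    T m and their adjoints. A nonzero vector of N can be moved into a cell of one
    operator after another, remaining nonzero and in N; it ends in a joint
    cell, hence is orthogonal to itself. *)
Lemma label_cells_total v : (forall i w, label_cells i w -> inner v w = 0) -> v = 0.
Proof.
move=> vN; apply: contrapT => v0.
pose N : set H := [set v | forall i w, label_cells i w -> inner v w = 0].
have NT m x : N x -> N (T m x).
  by move=> Nx i w /(label_cells_stable m)[_ iw]; rewrite adjointP; exact: Nx iw.
have NS m x : N x -> N (Ts m x).
  by move=> Nx i w /(label_cells_stable m)[iw _]; rewrite adjointP'; exact: Nx iw.
have Nsub x y : N x -> N y -> N (x - y).
  by move=> Nx Ny i w iw; rewrite innerBl (Nx i w iw) (Ny i w iw) subr0.
have [cd [w [Nw w0 wP]]] : exists cd : 'I_M -> option nat * option nat, exists w,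
    [/\ N w, w <> 0 & forall m, m \in enum 'I_M ->
      cell (T m) (Ts m) (cd m).1 (cd m).2 w].
  elim: (enum 'I_M) (enum_uniq 'I_M) => [_|m s IH /= /andP[ms us]].
    by exists (fun=> (None, None)), v; split.
  have {IH} [cd [w [Nw w0 wP]]] := IH us.
  (* The vectors of N already placed in a cell for each operator of s. It is stable
     under T m and its adjoint, so that the next cell can be found inside it. *)
  pose N' : set H := [set x | N x /\ forall n, n \in s ->
    cell (T n) (Ts n) (cd n).1 (cd n).2 x].
  have N'b (C : bop H H) : (forall x, N x -> N (C x)) ->
      (forall n, m <> n -> forall x, T n (C x) = C (T n x)) ->
      (forall n, m <> n -> forall x, Ts n (C x) = C (Ts n x)) ->
      forall x, N' x -> N' (C x).
    move=> NC CT CS x [Nx xP]; split; first exact: NC.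
    move=> n ns; have mn : m <> n by move=> mn; rewrite mn ns in ms.
    have [c d] := xP n ns; split; apply: cut_image => //; try exact: raddf0.
      by move=> k y; rewrite /range_proj (iter_comm (CS n mn)) (iter_comm (CT n mn)).
    by move=> k y; rewrite /range_proj (iter_comm (CT n mn)) (iter_comm (CS n mn)).
  have [||||c [d [u [[Nu uP] u0 mu]]]] :=
      cell_exists (N := N') (v := w) (pairT m) _ _ _ _ w0.
  - apply: N'b; [exact: NT| by move=> *; exact: commTT|].
    by move=> n mn x; rewrite commST// => /esym.
  - apply: N'b; [exact: NS| by move=> n mn x; rewrite [RHS]commST|].
    by move=> *; exact: commSS.
  - move=> x y [Nx xP] [Ny yP]; split; first exact: Nsub.
    move=> n ns; have [c d] := xP n ns; have [c' d'] := yP n ns.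
    by rewrite addrC -scaleN1r; split; exact: cut_linear.
  - by split.
  exists (fun n => if n == m then (c, d) else cd n), u; split => // n.
  rewrite inE; case: eqVneq => [->//|nm /= ns]; exact: uP.
have /choice[lk lkP] : forall m, exists lk : label * nat,
    valid lk.1 lk.2 /\ label_cuts lk.1 lk.2 = cd m.
  move=> m; have [l [k [v1 v2]]] := label_cuts_surj (cd m).1 (cd m).2.
  by exists (l, k); split => //; rewrite v2 -surjective_pairing.
apply: w0; apply: inner_xx_eq0; apply: (Nw (fun m => (lk m).1)).
exists (fun m => (lk m).2) => m; have [v1 v2] := lkP m => //.
by rewrite /label_cell v2; apply: wP; rewrite mem_enum.
Qed.

(** * Words in the operators, moving between joint cells *)

Section Words.
Variable i : 'I_M -> label.
Local Notation D := (fun m => fwd (i m) m).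
Local Notation D' := (fun m => bwd (i m) m).

(** The product over m in s of the x_m-th powers of the raising operators. *)
Definition word (x : 'I_M -> nat) (s : seq 'I_M) (y : H) : H :=
  foldr (fun m z => iter (x m) (D m) z) y s.

(** Words are built one operator at a time; this is the position reached from 0
    after the operators in s have been applied. *)
Definition mask (s : seq 'I_M) (x : 'I_M -> nat) : 'I_M -> nat :=
  fun m => if m \in s then x m else 0%N.

Lemma fwd_comm m n z : m <> n -> D m (D n z) = D n (D m z).
Proof.
move=> mn; have nm : n <> m by move=> /esym.
rewrite /fwd; case: (i m) => [|||p p0]; case: (i n) => [|||q q0];
  by [exact: commTT|exact: commSS|exact: commST|rewrite [RHS]commST].
Qed.

Lemma valid_pred l k : valid l k.+1 -> valid l k.
Proof. by case: l => //= p _; exact: ltnW. Qed.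

Lemma valid_succ_u l k : valid l k.+1 -> ~~ is_u l.
Proof. by case: l. Qed.

Lemma label_cell_iter_up m l k w : valid l k -> label_cell m l 0 w ->
  label_cell m l k (iter k (fwd l m) w).
Proof.
move=> lk w0; elim: k lk => //= k IH lk.
by have [] := label_cell_up (valid_succ_u lk) lk (IH (valid_pred lk)).
Qed.

Lemma iter_up_isom m l k w w' : valid l k ->
  label_cell m l 0 w -> label_cell m l 0 w' ->
  inner (iter k (fwd l m) w) (iter k (fwd l m) w') = inner w w'.
Proof.
move=> lk w0 w0'; elim: k lk => //= k IH lk.
have w1 := label_cell_iter_up (valid_pred lk) w0'.
rewrite fwd_adj; have [_ ->] := label_cell_up (valid_succ_u lk) lk w1.
by rewrite IH// valid_pred.
Qed.

Lemma label_cell_iter_down m l k w : valid l k -> label_cell m l k w ->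
  label_cell m l 0 (iter k (bwd l m) w) /\ iter k (fwd l m) (iter k (bwd l m) w) = w.
Proof.
elim: k w => //= k IH w lk wk.
have [h1 h2] := label_cell_down (valid_succ_u lk) lk wk.
have [h3 h4] := IH _ (valid_pred lk) h1.
by rewrite -iterS iterSr; split => //; rewrite h4.
Qed.

Lemma label_cell_iter (f : H -> H) m l k j w :
  (forall w, label_cell m l k w -> label_cell m l k (f w)) ->
  label_cell m l k w -> label_cell m l k (iter j f w).
Proof. by move=> fP wP; elim: j => //= j; exact: fP. Qed.

Lemma word_joint_cell x s y : uniq s -> (forall m, valid (i m) (x m)) ->
  joint_cell i (fun=> 0%N) y -> joint_cell i (mask s x) (word x s y).
Proof.
move=> us vx y0; elim: s us => [_ //|m s IH /= /andP[ms us]] n.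
have {}IH := IH us; rewrite /mask inE.
case: eqVneq => [->|/eqP nm] /=.
  by apply: label_cell_iter_up => //; have := IH m; rewrite /mask (negbTE ms).
by apply: label_cell_iter (IH n) => w; exact: label_cell_fwd.
Qed.

Lemma word_isom x s y y' : uniq s -> (forall m, valid (i m) (x m)) ->
  joint_cell i (fun=> 0%N) y -> joint_cell i (fun=> 0%N) y' ->
  inner (word x s y) (word x s y') = inner y y'.
Proof.
move=> us vx y0 y0'; elim: s us => //= m s IH /andP[ms us].
have h z : joint_cell i (fun=> 0%N) z -> label_cell m (i m) 0 (word x s z).
  by move=> /(word_joint_cell us vx)/(_ m); rewrite /mask (negbTE ms).
by rewrite iter_up_isom// ?IH//; exact: h.
Qed.

Lemma word_surj x s w : uniq s -> (forall m, valid (i m) (x m)) ->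
  joint_cell i (mask s x) w -> exists2 y, joint_cell i (fun=> 0%N) y & w = word x s y.
Proof.
move=> us vx; elim: s w us => [w _ w0|m s IH w /= /andP[ms us] wP].
  by exists w.
have := wP m; rewrite /mask inE eqxx /= => /(label_cell_iter_down (vx m))[z0 zw].
have [|y y0 yP] := IH (iter (x m) (D' m) w) us.
  move=> n; have := wP n; rewrite /mask inE; case: eqVneq => [->|/eqP nm] /= h.
    by rewrite (negbTE ms).
  by apply: label_cell_iter h => u; exact: label_cell_bwd.
by exists y => //; rewrite -yP zw.
Qed.

(** A coordinate at position 0 contributes no factor, so C has to commute only
    with the operators that occur. *)
Lemma word_comm x s (C : H -> H) y :
  (forall n, x n <> 0%N -> forall z, D n (C z) = C (D n z)) ->
  word x s (C y) = C (word x s y).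
Proof.
move=> DC; elim: s => //= n s ->; have [->//|/eqP/DC h] := eqVneq (x n) 0%N.
by rewrite (iter_comm h).
Qed.

Lemma word_update x m k s y : m \notin s -> word (update x m k) s y = word x s y.
Proof.
elim: s => //= n s IH; rewrite inE negb_or => /andP[mn ms].
by rewrite IH// /update eq_sym (negbTE mn).
Qed.

Lemma word_fwd x m s y : m \in s -> uniq s ->
  D m (word x s y) = word (update x m (x m).+1) s y.
Proof.
elim: s => //= n s IH; rewrite inE => /orP[/eqP <-|ms] /andP[ns us].
  by rewrite word_update// /update eqxx.
have nm : m <> n by move=> mn; rewrite -mn ms in ns.
rewrite -IH//= /update; case: eqVneq => [/esym//|_].
by apply/esym/(@iter_comm _ _ (D n) (D m)) => z; apply: fwd_comm => /esym.
Qed.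

Definition full_word x y := word x (enum 'I_M) y.

Lemma full_word_joint_cell x y : (forall m, valid (i m) (x m)) ->
  joint_cell i (fun=> 0%N) y -> joint_cell i x (full_word x y).
Proof.
move=> vx y0 m; have := @word_joint_cell x _ y (enum_uniq 'I_M) vx y0 m.
by rewrite /mask mem_enum.
Qed.

Lemma full_word_surj x w : (forall m, valid (i m) (x m)) -> joint_cell i x w ->
  exists2 y, joint_cell i (fun=> 0%N) y & w = full_word x y.
Proof.
move=> vx wx; apply: word_surj => // [|m]; first exact: enum_uniq.
by rewrite /mask mem_enum.
Qed.

(** Coordinatewise, S and J_p act as f |-> (k |-> 0 if k = 0, and f (k - 1)
    otherwise), and S' as f |-> (k |-> f (k + 1)). The predicate pull_zero and the
    index map pull_idx describe both. *)
Definition pull_zero (l : label) (k : nat) : bool :=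
  if l is lab_b then false else k == 0%N.
Definition pull_idx (l : label) (k : nat) : nat :=
  if l is lab_b then k.+1 else k.-1.

Lemma valid_pull l k : ~~ is_u l -> valid l k -> valid l (pull_idx l k).
Proof.
by case: l => //= p _ _ kp; apply: leq_ltn_trans kp; exact: leq_pred.
Qed.

(** For b the adjoint of T m is the raising operator. Otherwise it is the lowering
    operator, which undoes one raising step or kills the position 0. *)
Lemma adjoint_full_word m x y : (forall n, valid (i n) (x n)) -> ~~ is_u (i m) ->
  joint_cell i (fun=> 0%N) y ->
  adjoint (T m) (full_word x y) = if pull_zero (i m) (x m) then 0
    else full_word (update x m (pull_idx (i m) (x m))) y.
Proof.
move=> vx iu y0.
have [ib|ib] := pselect (i m = lab_b).
  rewrite ib /= /full_word; have := word_fwd x y (_ : m \in enum 'I_M) (enum_uniq _).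
  by rewrite ib mem_enum => ->.
have -> : adjoint (T m) = bwd (i m) m by move: ib; case: (i m).
have -> : pull_zero (i m) (x m) = (x m == 0%N) by move: ib; case: (i m).
have -> : pull_idx (i m) (x m) = (x m).-1 by move: ib; case: (i m).
case: eqP => [xm0|/eqP].
  by apply: label_cell_bottom => //; rewrite -xm0; exact: full_word_joint_cell.
case xm: (x m) => [//|k] _ /=.
set x' := update x m k.
have vx' n : valid (i n) (x' n).
  rewrite /x' /update; case: eqVneq => [->|_]//.
  by apply: valid_pred; rewrite -xm.
have -> : x = update x' m (x' m).+1.
  by apply/funext => n; rewrite /x' /update eqxx; case: eqVneq => [->|].
rewrite /full_word -word_fwd ?enum_uniq ?mem_enum// -/(full_word _ _).
have := @full_word_joint_cell x' y vx' y0 m.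
have vk : valid (i m) (x' m).+1 by rewrite /x' /update eqxx -xm.
by move=> /(label_cell_up iu vk)[_ ->].
Qed.

(** Words contain no power of T m when i_m = u, and the adjoint of T m commutes
    with the other operators. *)
Lemma full_word_adjoint_u m x y : i m = lab_u -> (forall n, valid (i n) (x n)) ->
  full_word x (adjoint (T m) y) = adjoint (T m) (full_word x y).
Proof.
move=> iu vx; apply: word_comm => n xn z.
have nm : n <> m by move=> nm; apply: xn; have := vx n; rewrite nm iu => /eqP.
have mn : m <> n by move=> /esym.
by rewrite /fwd; case: (i n); first [by move=> *; rewrite [RHS]commST|exact: commSS].
Qed.

End Words.
End Family.

(** * Tensor products of the factor spaces *)

(** The operator is pinned down by its values on elementary tensors, since these
    span a dense subspace. *)
Lemma tensor_opE (R : realType) (J : finType) (K : J -> hilbertType R)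
    (F : hilbertTensor K) (A : forall j, bop (K j) (K j)) (B : bop F F) :
  (forall x, B (tensor F x) = tensor F (fun j => A j (x j))) ->
  tensor_op F A =1 B.
Proof.
move=> BA; apply: (dense_ext (@tensor_dense _ _ _ F)) => _ [x _ <-].
by rewrite /tensor_op; case: xgetP => [S _ ->//|/(_ B)].
Qed.

Lemma tensor2_opE (R : realType) (H K : hilbertType R) (E : hilbertTensor2 H K)
    (A : bop H H) (B : bop K K) (C : bop E E) :
  (forall x y, C (tensor2 E x y) = tensor2 E (A x) (B y)) ->
  tensor2_op E A B =1 C.
Proof.
move=> CA; apply: (dense_ext (@tensor2_dense _ _ _ E)) => _ [x [y ->]].
by rewrite /tensor2_op; case: xgetP => [S _ ->//|/(_ C)].
Qed.

Section Coordinates.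
Variable R : realType.
Local Notation C := (R[i]).

(** All factors are read as families on N, extended by 0 beyond p for C^p, so that
    a product of factors is indexed by plain functions J -> nat. *)
Definition coord (l : label) : Defs.factor R l -> nat -> C :=
  match l return Defs.factor R l -> nat -> C with
  | lab_fin p _ => fun v k => if insub k is Some k' then (v : l2 R 'I_p) k' else 0
  | _ => fun v k => (v : l2 R nat) k
  end.

Lemma coord_linear l a (u v : Defs.factor R l) k :
  coord (a *: u + v) k = a * coord u k + coord v k.
Proof.
by case: l u v => [|||p p0] u v //=; case: insub => [?|] //; rewrite mulr0 addr0.
Qed.

Lemma coord_invalid l (v : Defs.factor R l) k : ~~ is_u l -> ~~ valid l k ->
  coord v k = 0.
Proof.
by case: l v => [|||p p0] v //= _ kp; case: insubP => [k'|//]; rewrite (negbTE kp).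
Qed.

(** The partial sums are constant from p on in the case of C^p. *)
Lemma coord_inner l (v w : Defs.factor R l) :
  (fun N => \sum_(k < N) coord v k * Num.conj (coord w k) : C^o) @ \oo -->
  (inner v w : C^o).
Proof.
have natcase (f g : l2 R nat) :
    (fun N => \sum_(k < N) f k * Num.conj (g k) : C^o) @ \oo --> (inner f g : C^o).
  pose B N : {fset nat} := [fset k in iota 0 N]%fset.
  have cB : forall A : {fset nat}, exists N,
      forall n, (N <= n)%N -> (A `<=` B n)%fset.
    move=> A; exists (\max_(k <- A) k.+1)%N => n An; apply/fsubsetP => k kA.
    rewrite !inE/= mem_iota/= add0n; apply: leq_trans An.
    exact: (@leq_bigmax_seq _ _ (fun=> true) (fun k => k.+1)).
  apply: cvg_trans (csum_cofinal (l2_inner_summable f g) cB).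
  apply: near_eq_cvg; apply: nearW => N /=.
  rewrite -(big_mkord xpredT (fun k => f k * Num.conj (g k))) /index_iota subn0.
  by apply/perm_big/uniq_perm; rewrite ?fset_uniq ?iota_uniq// => k; rewrite !inE.
case: l v w => [|||p p0] v w; [exact: natcase..|].
apply: cvg_near_cst; exists p => // N /= pN.
rewrite l2_fin_inner -(subnKC pN) big_split_ord/= [X in _ + X]big1 ?addr0.
  by apply: eq_bigr => k _; rewrite /coord/= valK.
by move=> k _; rewrite insubF ?mul0r// ltnNge leq_addr.
Qed.

(** The partial sums increase to the inner product. *)
Lemma coord_sq_le l (v : Defs.factor R l) N :
  \sum_(k < N) `|coord v k| ^+ 2 <= inner v v.
Proof.
rewrite -subr_ge0.
have cv : (fun n => (\sum_(k < n) coord v k * Num.conj (coord v k)) -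
    (\sum_(k < N) `|coord v k| ^+ 2) : C^o) @ \oo -->
    (inner v v - \sum_(k < N) `|coord v k| ^+ 2 : C^o).
  by apply: (@cvgB _ C^o); [exact: coord_inner|exact: cvg_cst].
apply: (limC_ge0 _ cv); exists N => // n /= Nn.
rewrite subr_ge0 -(subnKC Nn) big_split_ord/=.
under eq_bigr do rewrite normCK.
by rewrite lerDl sumr_ge0// => k _; rewrite -normCK exprn_ge0.
Qed.

Lemma coord_delta l k : ~~ is_u l -> valid l k ->
  exists v : Defs.factor R l, forall k', valid l k' -> coord v k' = (k' == k)%:R.
Proof.
case: l => [|||p p0] //= _ lk; [by exists (l2_delta R k)|by exists (l2_delta R k)|].
exists (l2_delta R (Ordinal lk)) => k' lk'.
by rewrite insubT/= /l2_delta_fun -val_eqE.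
Qed.

Lemma adjoint_shift (v : l2 R nat) k : adjoint (unilateral_shift R) v k = v k.+1.
Proof. by rewrite -!l2_inner_delta adjointP' shift_delta. Qed.

Lemma coord_op l (v : Defs.factor R l) k : ~~ is_u l -> valid l k ->
  coord (factor_op R l v) k = if pull_zero l k then 0 else coord v (pull_idx l k).
Proof.
case: l v => [|||p p0] v //= _ lk; first exact: adjoint_shift.
rewrite insubT/= /pullback/=; case: ifP => // k0.
have kp : (k.-1 < p)%N by apply: leq_ltn_trans lk; exact: leq_pred.
rewrite insubT/=; congr (l2_fun v _); apply/val_inj.
by apply: (@ord_predE p (Ordinal lk)); rewrite /= k0.
Qed.

End Coordinates.

Section FactorTensor.
Variables (R : realType) (J : finType) (lab : J -> label).
Hypothesis lab_not_u : forall j, ~~ is_u (lab j).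
Local Notation C := (R[i]).
Local Notation K := (fun j => Defs.factor R (lab j)).

Definition multi_index_pred : pred {ffun J -> nat} :=
  fun x => [forall j, valid (lab j) (x j)].
(** The index set of the product basis: one position for each factor. *)
Definition multi_index : choiceType := {x : {ffun J -> nat} | multi_index_pred x}.

Lemma multi_index_valid (x : multi_index) j : valid (lab j) (val x j).
Proof. by have /forallP := valP x. Qed.

Definition multi_index0 : multi_index.
Proof. by exists [ffun=> 0%N]; apply/forallP => j; rewrite ffunE valid0. Defined.

Let to_multi_index N (g : {ffun J -> 'I_N}) : multi_index :=
  insubd multi_index0 [ffun j => g j : nat].

Let valid_ord N : pred {ffun J -> 'I_N} := fun g => [forall j, valid (lab j) (g j)].

Let to_multi_indexE N (g : {ffun J -> 'I_N}) j : valid_ord g ->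
  val (to_multi_index g) j = g j.
Proof.
move=> /forallP gv; rewrite /to_multi_index val_insubd.
rewrite (_ : multi_index_pred _) ?ffunE//.
by apply/forallP => k; rewrite ffunE.
Qed.

Let box N : {fset multi_index} :=
  [fset to_multi_index g | g in [fset g : {ffun J -> 'I_N} | valid_ord g]]%fset.

Let box_sum N (a : J -> nat -> C) :
  (forall j k, ~~ valid (lab j) k -> a j k = 0) ->
  \sum_(x <- box N) \prod_j a j (val x j) = \prod_j \sum_(k < N) a j k.
Proof.
move=> a0; rewrite bigA_distr_bigA/= big_imfset/=; last first.
  move=> g h; rewrite !inE/= => gv hv gh; apply/ffunP => j; apply/val_inj.
  by have := to_multi_indexE j gv; rewrite gh to_multi_indexE.
rewrite big_uniq ?fset_uniq// big_mkcond/=; apply: eq_bigr => g _.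
rewrite !inE/=; case: ifPn => [gv|].
  by apply: eq_bigr => j _; rewrite to_multi_indexE.
by rewrite negb_forall => /existsP[j /a0 aj]; rewrite (bigD1 j)//= aj mul0r.
Qed.

Let box_cofinal (A : {fset multi_index}) :
  exists N, forall n, (N <= n)%N -> (A `<=` box n)%fset.
Proof.
exists (\max_(x <- A) \max_j (val x j).+1)%N => n An; apply/fsubsetP => x xA.
have xn j : (val x j < n)%N.
  have h1 := @leq_bigmax _ (fun j => (val x j).+1) j.
  apply: (leq_trans h1); apply: leq_trans An.
  exact: (@leq_bigmax_seq _ _ (fun=> true)
    (fun x : multi_index => \max_j (val x j).+1)%N).
apply/imfsetP; exists [ffun j => Ordinal (xn j)].
  by rewrite !inE/=; apply/forallP => j; rewrite ffunE/= multi_index_valid.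
apply/val_inj/ffunP => j; rewrite to_multi_indexE ?ffunE//.
by apply/forallP => k; rewrite ffunE/= multi_index_valid.
Qed.

Definition tensor_fun (v : forall j, K j) : multi_index -> C^o :=
  fun x => \prod_j coord (v j) (val x j).

(** A finite set of multi-indices lies in a box, where the sum of the products is
    the product of the sums. *)
Fact tensor_fun_l2 v : tensor_fun v \in @l2_pred R multi_index.
Proof.
apply/asboolP; exists (\prod_j inner (v j) (v j)) => A.
have [N /(_ N (leqnn N)) AN] := box_cofinal A.
apply: (@le_trans _ _ (\sum_(x <- box N) \prod_j `|coord (v j) (val x j)| ^+ 2)).
  rewrite (big_fset_subset _ AN) -[X in X <= _]addr0 lerD//.
    by apply: ler_sum => x _; rewrite /tensor_fun normr_prod prodrXl.
  by apply: sumr_ge0 => x _; apply: prodr_ge0 => j _; rewrite exprn_ge0.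
rewrite (box_sum _ (a := fun j k => `|coord (v j) k| ^+ 2)); last first.
  by move=> j k kv; rewrite coord_invalid// normr0 expr0n.
apply: ler_prod => j _; rewrite coord_sq_le andbT.
by apply: sumr_ge0 => k _; rewrite exprn_ge0.
Qed.

(** The elementary tensor of v as the family of the products of coordinates. *)
Definition ftensor v : l2 R multi_index := L2 (tensor_fun_l2 v).

Lemma ftensor_linear v j (a : C) (u w : K j) :
  ftensor (dfwith v (a *: u + w)) = a *: ftensor (dfwith v u) + ftensor (dfwith v w).
Proof.
apply/val_inj/funext => x.
have E (z : K j) : ftensor (dfwith v z) x =
    coord z (val x j) * \prod_(k | k != j) coord (v k) (val x k).
  rewrite /= /tensor_fun (bigD1 j)//= dfwith_in; congr (_ * _).
  by apply: eq_bigr => k kj; rewrite dfwith_out// eq_sym.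
have -> : val (a *: ftensor (dfwith v u) + ftensor (dfwith v w)) x =
  a * ftensor (dfwith v u) x + ftensor (dfwith v w) x by [].
by rewrite [LHS]E !E coord_linear mulrDl mulrA.
Qed.

(** Both sides are limits over the boxes with side N, where the sum of the
    products is the product of the sums. *)
Lemma ftensor_inner v w : inner (ftensor v) (ftensor w) = \prod_j inner (v j) (w j).
Proof.
have cv := csum_cofinal (l2_inner_summable (ftensor v) (ftensor w)) box_cofinal.
apply: (cvgC_unique cv).
pose a N j := \sum_(k < N) coord (v j) k * Num.conj (coord (w j) k).
have aP : (fun N => \prod_j a N j : C^o) @ \oo --> (\prod_j inner (v j) (w j) : C^o).
  apply: (@cvg_big C^o) => [|j _]; first exact: mul_continuous.
  exact: coord_inner.
apply: cvg_trans aP; apply: near_eq_cvg; apply: nearW => N /=.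
rewrite -(box_sum _ (a := fun j k => coord (v j) k * Num.conj (coord (w j) k))).
  by apply: eq_bigr => x _; rewrite /tensor_fun rmorph_prod -big_split.
by move=> j k kv; rewrite coord_invalid// mul0r.
Qed.

Lemma ftensor_delta x : exists v, ftensor v = l2_delta R x.
Proof.
have vex j : exists v : K j, forall k', valid (lab j) k' ->
    coord v k' = (k' == val x j)%:R.
  by apply: coord_delta => //; exact: multi_index_valid.
pose v j := projT1 (cid (vex j)).
have vP j := projT2 (cid (vex j)).
exists v; apply/val_inj/funext => y /=.
rewrite /tensor_fun /l2_delta_fun.
under eq_bigr => j _ do rewrite vP ?multi_index_valid//.
have [->|yx] := eqVneq y x; first by rewrite big1// => j _; rewrite eqxx.
have [j yj] : exists j, val y j != val x j.
  apply/existsP; move: yx; apply: contraR; rewrite negb_exists => /forallP h.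
  by apply/eqP/val_inj/ffunP => j; have /negPn/eqP := h j.
by rewrite (bigD1 j)//= (negbTE yj) mul0r.
Qed.

Lemma ftensor_dense : dense (lin_span (range ftensor)).
Proof.
apply: total_dense => f fP; apply: l2_deltas_total => x.
by have [v <-] := ftensor_delta x; apply: fP; exists v.
Qed.

Definition factor_tensor : hilbertTensor K :=
  HilbertTensor ftensor_linear ftensor_inner ftensor_dense.

Section Pull.
Variable n : J.

Definition pull_pred : pred multi_index := fun x => pull_zero (lab n) (val x n).

Fact pull_multi_index_subproof (x : multi_index) :
  multi_index_pred [ffun j => if j == n then pull_idx (lab n) (val x n) else val x j].
Proof.
apply/forallP => j; rewrite ffunE; case: eqVneq => [->|_];
  last exact: multi_index_valid.
by apply: valid_pull => //; exact: multi_index_valid.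
Qed.

Definition pull_multi_index (x : multi_index) : multi_index :=
  Sub _ (pull_multi_index_subproof x).

Lemma pull_multi_index_inj : {in predC pull_pred &, injective pull_multi_index}.
Proof.
move=> x y; rewrite !inE /pull_pred => xn yn /(congr1 val)/ffunP/= xy.
apply/val_inj/ffunP => j; have := xy j; rewrite !ffunE; case: eqVneq => [->|//].
move: xn yn; rewrite /pull_zero /pull_idx; case: (lab n) => [|||p p0];
  by case: (val x n) (val y n) => [|a] [|b]//= _ _ []->.
Qed.

(** The operator that acts as the factor operator of the label lab n on the factor
    n and as the identity on the others, described on families. *)
Definition pull_coord_op : bop (l2 R multi_index) (l2 R multi_index) :=
  pullback_op R pull_multi_index_inj.

Lemma pull_coord_op_tensor v : pull_coord_op (ftensor v) =
  ftensor (fun j => (if j == n then factor_op R (lab j) else bop_id _) (v j)).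
Proof.
apply/val_inj/funext => x; rewrite /= /pullback /pull_pred/= /tensor_fun.
rewrite [RHS](bigD1 n)//= eqxx coord_op ?multi_index_valid//.
case: ifP => [_|nz]; first by rewrite mul0r.
rewrite [LHS](bigD1 n)//= ffunE eqxx; congr (_ * _).
by apply: eq_bigr => j jn; rewrite ffunE (negbTE jn).
Qed.

End Pull.
End FactorTensor.

(** * The summands as tensor products *)

Section Decomposition.
Variables (R : realType) (H : hilbertType R) (M : nat) (T : 'I_M -> bop H H).
Hypothesis sc : star_commuting T.
Hypothesis pT : forall m, power_partial_isometry (T m).
Local Notation C := (R[i]).

(** The conditions that define a cut are equalities of self-adjoint maps. *)
Lemma biperp_cut (A B : bop H H) c (S : set H) x : ppi_pair A B ->
  S `<=` cut A B c -> perp (perp S) x -> cut A B c x.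
Proof.
move=> AB Sc xS; have sa := range_proj_self_adjoint AB.
case: c Sc => [a|] Sc /=; last first.
  move=> n; apply: (@biperp_eq _ _ S _ id) => // u /Sc; exact.
split; first by apply: (@biperp_eq _ _ S _ id) => // u /Sc[].
apply: (@biperp_eq _ _ S _ (fun=> 0)) => //; last by move=> u /Sc[].
by move=> u v; rewrite inner0l inner0r.
Qed.

Section Index.
Variable i : 'I_M -> label.

(** The closed span of the joint cells of label i, as a double complement: closed
    by construction, and stable under an operator as soon as the joint cells are. *)
Definition label_space : closedSubspace H := perp_space (perp (label_cells T i)).
(** By [mult_space_joint_cell] this double complement is the joint cell at 0
    itself; the form supplies closedness. *)
Definition mult_space : closedSubspace H :=
  perp_space (perp (joint_cell T i (fun=> 0%N))).

Lemma mult_space_joint_cell (y : cs_type mult_space) :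
  joint_cell T i (fun=> 0%N) (val y).
Proof.
move=> m; have yM : perp (perp (joint_cell T i (fun=> 0%N))) (val y).
  exact: (set_mem (cs_valP y)).
split.
  by apply: (biperp_cut (pairT pT m) _ yM) => u /(_ m)[].
by apply: (biperp_cut (pairTs pT m) _ yM) => u /(_ m)[].
Qed.

Lemma joint_cell_mult_space y : joint_cell T i (fun=> 0%N) y ->
  y \in cs_pred mult_space.
Proof. by move=> y0; apply: mem_set; exact: sub_biperp. Qed.

Lemma label_space_reducing m : reducing label_space (T m).
Proof.
split=> _ [x xH <-] u uP.
- rewrite adjointP; apply: xH => w wi; rewrite adjointP'; apply: uP.
  exact: (label_cells_stable sc pT m wi).1.
- rewrite adjointP'; apply: xH => w wi; rewrite adjointP; apply: uP.
  exact: (label_cells_stable sc pT m wi).2.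
Qed.

Lemma mult_space_invariant m : i m = lab_u -> invariant_subspace mult_space (T m).
Proof.
move=> iu _ [y yM <-]; apply: sub_biperp => n.
have := mult_space_joint_cell (CsType (mem_set yM : y \in cs_pred mult_space)) n.
move=> /= yn.
have [nm|nm] := pselect (n = m); last exact: label_cell_T.
by move: yn; rewrite nm iu => /(label_cell_u pT)[].
Qed.

(** The unitary V_(i,m) is the restriction of T m, which preserves M_i
    when i_m = u; the identity is the default for the other m. *)
Definition mult_op m : bop (cs_type mult_space) (cs_type mult_space) :=
  match pselect (i m = lab_u) with
  | left iu => restrict_op (mult_space_invariant iu)
  | right _ => bop_id _
  end.

Lemma mult_opE m y : i m = lab_u -> val (mult_op m y) = T m (val y).
Proof. by rewrite /mult_op; case: pselect. Qed.

Lemma cs_innerE (K : closedSubspace H) (x y : cs_type K) :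
  inner x y = inner (val x) (val y).
Proof. by []. Qed.

Lemma mult_op_unitary m : i m = lab_u -> unitary_op (mult_op m).
Proof.
move=> iu; split=> [x y|y].
  rewrite !cs_innerE !mult_opE// adjointP.
  have := mult_space_joint_cell y m; rewrite iu.
  by move=> /(label_cell_u pT)[_ _ -> _].
have ym := mult_space_joint_cell y.
have := ym m; rewrite iu => /(label_cell_u pT)[_ h _ TT].
have /joint_cell_mult_space yM : joint_cell T i (fun=> 0%N) (adjoint (T m) (val y)).
  move=> n; have [->|nm] := pselect (n = m); first by rewrite iu.
  exact: label_cell_Ts.
by exists (CsType yM); apply/val_inj; rewrite mult_opE.
Qed.

Lemma mult_op_comm m n : i m = lab_u -> i n = lab_u ->
  bop_comp (mult_op m) (mult_op n) =1 bop_comp (mult_op n) (mult_op m).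
Proof. by move=> im jn y; apply/val_inj; rewrite /= !mult_opE//; exact: commTT. Qed.

Let lab (n : Sigma i) := i (val n).
Let lab_not_u n : ~~ is_u (lab n). Proof. exact: (valP n). Qed.
Local Notation X := (multi_index lab).

(** A multi-index lives on the m with i_m different from u; it is extended by 0, the
    only position on the label u. *)
Definition positions (x : X) : 'I_M -> nat :=
  fun m => if insub m is Some n then val x n else 0%N.

Lemma positions_val x n : positions x (val n) = val x n.
Proof. by rewrite /positions valK. Qed.

Lemma positions_valid x m : valid (i m) (positions x m).
Proof.
rewrite /positions; case: insubP => [n _ <-|]; first exact: multi_index_valid.
by move=> _; exact: valid0.
Qed.

Lemma positions_eq x y : positions x = positions y -> x = y.
Proof. by move=> xy; apply/val_inj/ffunP => n; rewrite -!positions_val xy. Qed.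

Lemma positions_surj f : (forall m, valid (i m) (f m)) -> exists x, positions x = f.
Proof.
move=> fv; have xv : @multi_index_pred _ lab [ffun n => f (val n)].
  by apply/forallP => n; rewrite ffunE; exact: fv.
exists (Sub _ xv); apply/funext => m; rewrite /positions.
case: insubP => [n _ <-|]; first by rewrite /= ffunE.
by rewrite negbK; have := fv m; case: (i m) => //= /eqP->.
Qed.

Lemma positions_pull n x : positions (pull_multi_index lab_not_u n x) =
  update (positions x) (val n) (pull_idx (i (val n)) (positions x (val n))).
Proof.
apply/funext => m; rewrite /update positions_val {1}/positions.
case: insubP => [k _ <-|mu] /=; last first.
  case: eqVneq => [mn|_]; last by rewrite /positions insubF// (negbTE mu).
  by move: mu; rewrite mn; have := valP n => /= ->.
by rewrite ffunE; case: (eqVneq k n) => [->|kn];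
  rewrite ?eqxx// -[sval k == sval n]/(val k == val n) val_eqE (negbTE kn)
    positions_val.
Qed.

Definition word_vec (x : X) (y : cs_type mult_space) : H :=
  full_word T i (positions x) (val y).

Lemma word_vec_joint_cell x y : joint_cell T i (positions x) (word_vec x y).
Proof.
exact: (full_word_joint_cell sc pT (positions_valid x) (mult_space_joint_cell y)).
Qed.

Lemma word_vec_inner x x' y y' :
  inner (word_vec x y) (word_vec x' y') = if x == x' then inner y y' else 0.
Proof.
case: eqVneq => [->|xx].
  apply: (word_isom sc pT (enum_uniq _) (positions_valid x'));
    exact: mult_space_joint_cell.
apply: (joint_cell_orthogonal pT (positions_valid x) (positions_valid x')
  (word_vec_joint_cell x y) (word_vec_joint_cell x' y')).
apply: contrapT => /forallNP h; move/eqP: xx; apply; apply: positions_eq.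
by apply/funext => m; have /contrapT[] := h m.
Qed.

Lemma word_vec_label_space x y : cs_set label_space (word_vec x y).
Proof.
by apply: sub_biperp; exists (positions x);
  [exact: positions_valid|exact: word_vec_joint_cell].
Qed.

Lemma word_vec_total (v : cs_type label_space) :
  (forall x y, inner (val v) (word_vec x y) = 0) -> v = 0.
Proof.
move=> v0; apply/val_inj; apply: (@biperp_total _ _ (label_cells T i)).
  exact: (set_mem (cs_valP v)).
move=> w [f fv fw]; have [x xf] := positions_surj fv.
have [y y0 ->] := full_word_surj sc pT fv fw.
by have := v0 x (CsType (joint_cell_mult_space y0)); rewrite /word_vec xf.
Qed.

Lemma word_vec_ext (v v' : cs_type label_space) :
  (forall x y, inner (val v) (word_vec x y) = inner (val v') (word_vec x y)) ->
  v = v'.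
Proof.
move=> vv; apply/eqP; rewrite -subr_eq0; apply/eqP/word_vec_total => x y.
by rewrite raddfB/= innerBl vv subrr.
Qed.

Lemma tensor_series_exists (f : l2 R X) (y : cs_type mult_space) :
  exists v : cs_type label_space,
  (fun A : {fset X} => \sum_(x <- A) f x *: word_vec x y : H) @ totally --> val v.
Proof.
have [||v vP] := @orthogonal_series R X H (fun x => word_vec x y) (inner y y) f.
- by rewrite inner_norm exprn_ge0.
- by move=> x x'; exact: word_vec_inner.
suff vH : v \in cs_pred label_space by exists (CsType vH).
apply: mem_set => u uP; apply: (cvgC_unique (cvg_innerl (z := u) vP)).
apply: cvg_near_cst; apply: nearW => A.
rewrite inner_suml big1// => x _; rewrite innerZl.
by rewrite (inner_eq0C (uP _ _)) ?mulr0//; exists (positions x);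
  [exact: positions_valid|exact: word_vec_joint_cell].
Qed.

(** The elementary tensor of f and y in H_i. *)
Definition tensor_series (f : l2 R X) y : cs_type label_space :=
  projT1 (cid (tensor_series_exists f y)).

Lemma tensor_series_cvg (f : l2 R X) y :
  (fun A : {fset X} => \sum_(x <- A) f x *: word_vec x y : H) @ totally -->
  val (tensor_series f y).
Proof. exact: (projT2 (cid (tensor_series_exists f y))). Qed.

Lemma tensor_series_word_vec (f : l2 R X) y x y' :
  inner (val (tensor_series f y)) (word_vec x y') = f x * inner y y'.
Proof.
apply: (cvgC_unique (cvg_innerl (z := word_vec x y') (@tensor_series_cvg f y))).
apply: cvg_near_cst; exists [fset x]%fset => //= A xA.
rewrite (big_fset_subset _ xA) big_seq_fset1 innerDl innerZl word_vec_inner eqxx.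
rewrite inner_suml big_seq big1 ?addr0// => z.
by rewrite !inE innerZl word_vec_inner => /andP[/negbTE-> _]; rewrite mulr0.
Qed.

Lemma tensor_series_linearl y : linear (tensor_series ^~ y).
Proof.
move=> a f g; apply: word_vec_ext => x y'.
have -> : val (a *: tensor_series f y + tensor_series g y) =
  a *: val (tensor_series f y) + val (tensor_series g y) by [].
rewrite innerDl innerZl !tensor_series_word_vec.
have -> : (a *: f + g) x = a * f x + g x by [].
by rewrite mulrDl mulrA.
Qed.

Lemma tensor_series_linearr f : linear (tensor_series f).
Proof.
move=> a y z; apply: word_vec_ext => x y'.
have -> : val (a *: tensor_series f y + tensor_series f z) =
  a *: val (tensor_series f y) + val (tensor_series f z) by [].
by rewrite innerDl innerZl !tensor_series_word_vec innerDl innerZl; ring.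
Qed.

Lemma tensor_series_inner f g y z :
  inner (tensor_series f y) (tensor_series g z) = inner f g * inner y z.
Proof.
rewrite cs_innerE.
apply: (cvgC_unique
  (cvg_innerr (z := val (tensor_series f y)) (@tensor_series_cvg g z))).
have cv := abs_summable_cvg (l2_inner_summable f g).
have : (fun A =>
    partial_sum (fun x => f x * Num.conj (g x) : C^o) A * inner y z : C^o)
    @ totally --> (inner f g * inner y z : C^o).
  by apply: (@cvgM C); [exact: cv|exact: cvg_cst].
apply: cvg_trans; apply: near_eq_cvg; apply: nearW => A /=.
rewrite partial_sumE inner_sumr mulr_suml; apply: eq_bigr => x _.
by rewrite innerZr tensor_series_word_vec; ring.
Qed.

Lemma tensor_series_delta x y : val (tensor_series (l2_delta R x) y) = word_vec x y.
Proof.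
have wH : word_vec x y \in cs_pred label_space.
  exact: mem_set (word_vec_label_space x y).
suff -> : tensor_series (l2_delta R x) y = CsType wH by [].
apply: word_vec_ext => x' y'.
rewrite tensor_series_word_vec/= word_vec_inner /l2_delta_fun eq_sym.
by case: eqP; rewrite ?mul1r ?mul0r.
Qed.

Lemma tensor_series_dense :
  dense (lin_span [set z | exists f y, z = tensor_series f y]).
Proof.
apply: total_dense => v vP; apply: word_vec_total => x y.
by rewrite -tensor_series_delta -cs_innerE; apply: vP; exists (l2_delta R x), y.
Qed.

Definition model_F : hilbertTensor (factors R i) := factor_tensor R lab_not_u.

Definition model_E : hilbertTensor2 model_F (cs_type mult_space) :=
  HilbertTensor2 tensor_series_linearl tensor_series_linearr tensor_series_inner
    tensor_series_dense.

Lemma restrict_u m f y : i m = lab_u ->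
  restrict_op (label_space_reducing m).1 (tensor_series f y) =
  tensor_series f (mult_op m y).
Proof.
move=> iu; apply: word_vec_ext => x y'; rewrite tensor_series_word_vec.
rewrite [LHS](adjointP (T m)) /word_vec -full_word_adjoint_u//;
  last exact: positions_valid.
have ym := mult_space_joint_cell y'.
have := ym m; rewrite iu => /(label_cell_u pT)[_ h _ _].
have /joint_cell_mult_space yM : joint_cell T i (fun=> 0%N) (adjoint (T m) (val y')).
  move=> n; have [->|nm] := pselect (n = m); first by rewrite iu.
  exact: label_cell_Ts.
rewrite -[adjoint (T m) (val y')]/(val (CsType yM)) [LHS]tensor_series_word_vec.
by rewrite !cs_innerE mult_opE//= adjointP.
Qed.

(** Against a word W_x y the operator T m acts as its adjoint on the word, which
    changes the coordinate of x on the factor n as the pullback does. *)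
Lemma restrict_nu (n : Sigma i) f y :
  restrict_op (label_space_reducing (val n)).1 (tensor_series f y) =
  tensor_series (pull_coord_op R lab_not_u n f) y.
Proof.
apply: word_vec_ext => x y'; rewrite tensor_series_word_vec.
rewrite [LHS](adjointP (T (val n))) /word_vec adjoint_full_word//;
  last exact: mult_space_joint_cell.
  rewrite -positions_pull/= /pullback /pull_pred positions_val.
  by case: ifP => _; [rewrite inner0r mul0r|exact: tensor_series_word_vec].
- exact: positions_valid.
- exact: lab_not_u.
Qed.

Lemma restrict_model m :
  model_op model_E mult_op m =1
  (restrict_op (label_space_reducing m).1 : bop model_E model_E).
Proof.
rewrite /model_op; case: ifPn => im.
  apply: tensor2_opE => f y; have iu : i m = lab_u by move: im; case: (i m).
  rewrite (@tensor_opE _ _ _ model_F _ (bop_id _))//.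
  exact: restrict_u.
apply: tensor2_opE => f y.
pose n : Sigma i := Sub m im.
rewrite (@tensor_opE _ _ _ model_F _ (pull_coord_op R lab_not_u n))//;
  first exact: (restrict_nu n).
move=> v; rewrite [LHS]pull_coord_op_tensor.
congr (tensor model_F _).
Qed.

End Index.

Lemma label_space_orthogonal_sum : orthogonal_direct_sum label_space.
Proof.
split=> [i j ij x y xi yj|].
  by apply: xi => w wi; apply: yj => u uj;
    exact: (label_cells_orthogonal pT ij wi uj).
apply: total_dense => v vP; apply: (label_cells_total sc pT) => i w wi.
by apply: vP; exists i => //; exact: sub_biperp.
Qed.

End Decomposition.

Theorem theorem3p1 (R : realType) (H : hilbertType R) (M : nat)
    (T : 'I_M -> bop H H) :
  (0 < M)%N ->
  star_commuting T ->
  (forall m, power_partial_isometry (T m)) ->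
  exists (Hs : ('I_M -> label) -> closedSubspace H)
    (Hs_red : forall i m, reducing (Hs i) (T m))
    (Ms : ('I_M -> label) -> hilbertType R)
    (V : forall i : 'I_M -> label, 'I_M -> bop (Ms i) (Ms i)),
    orthogonal_direct_sum Hs /\
    (forall i m, i m = lab_u -> unitary_op (V i m)) /\
    (forall i m n, i m = lab_u -> i n = lab_u ->
      bop_comp (V i m) (V i n) =1 bop_comp (V i n) (V i m)) /\
    (forall i, exists (F : hilbertTensor (factors R i))
                      (E : hilbertTensor2 F (Ms i)),
      simul_unitarily_equiv (fun m => restrict_op (proj1 (Hs_red i m)))
                            (model_op E (V i))).
Proof.
move=> _ sc pT.
exists (label_space T), (label_space_reducing sc pT), (fun i =>
  cs_type (mult_space T i)), (mult_op sc pT).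
split; first exact: label_space_orthogonal_sum.
split; first by move=> i m; exact: mult_op_unitary.
split; first by move=> i m n; exact: mult_op_comm.
move=> i; exists (model_F R i), (model_E sc pT i).
exists (bop_id (cs_type (label_space T i))); first by split => // y; exists y.
move=> m z; rewrite restrict_model /=.
by rewrite (adjoint_eq (s := id)).
Qed.
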